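(* Let $\Gamma$ be a countable sofic group. Then the Determinant Conjecture holds for $\Gamma$: for every $d\geq1$ and every positive self-adjoint operator $\Delta\in\mathrm{Mat}_{d\times d}(\mathbb Z\Gamma)$ one has $\ln\det_{\mathcal N}(\Delta)\ge0$.
   Context: For $n\ge1$, $S_n$ is the symmetric group on $n$ elements and $\#_{\rm fix}\pi$ is the number of fixed points of $\pi\in S_n$. A group $\Gamma$ is sofic if for every real $0<\varepsilon<1$ and every finite subset $F\subseteq\Gamma$ there exist a natural number $n\ge 1$ and a function $\phi:\Gamma\to S_n$ such that (a) $\#_{\rm fix}(\phi(e)\phi(f)\phi(ef)^{-1})\ge(1-\varepsilon)n$ for all $e,f\in F$; (b) $\phi(1)=1$; (c) $\#_{\rm fix}\phi(e)\le\varepsilon n$ for every $1\ne e\in F$. Let $N\Gamma$ be the group von Neumann algebra of $\Gamma$ with its usual trace $\mathrm{Tr}_\Gamma$, extended to $\mathrm{Mat}_{d\times d}(N\Gamma)$ by $\mathrm{Tr}_\Gamma(A)=\sum_{i=1}^d\mathrm{Tr}_\Gamma(a_{ii})$. Matrices over $\mathbb Z\Gamma$ are viewed in $\mathrm{Mat}_{d\times d}(N\Gamma)$, acting on $[\ell^2(\Gamma)]^d$; positive means $\langle\Delta f,f\rangle\ge0$ for all $f$. For positive self-adjoint $\Delta\in \mathrm{Mat}_{d\times d}(N\Gamma)$ the spectral density function is $F_\Delta(\lambda)=\mathrm{Tr}_\Gamma\,\chi_{[0,\lambda]}(\Delta)$, so $F_\Delta(0)=\dim_\Gamma(\ker\Delta)$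 is the trace of the projection onto $\ker\Delta$. The Fuglede–Kadison determinant is given by $\ln\det_{\mathcal N}(\Delta)=\int_{0^+}^\infty\ln(\lambda)\,dF_\Delta(\lambda)$ if the integral converges, and $\ln\det_{\mathcal N}(\Delta)=-\infty$ otherwise. *)

(* Defs.v *)
From HB Require Import structures.
From mathcomp Require Import all_boot all_order all_algebra all_fingroup finmap.
From mathcomp Require Import all_classical all_reals all_analysis.
From mathcomp Require Import complex ring.

Set Implicit Arguments.
Unset Strict Implicit.
Unset Printing Implicit Defensive.

Import Order.TTheory GRing.Theory Num.Theory.
Import numFieldNormedType.Exports.

Local Open Scope classical_set_scope.
Local Open Scope ring_scope.

Definition nfix (n : nat) (s : 'S_n) : nat := #|[pred i | s i == i]|.

(* The product of 'S_n composes permutations from left to right.  The choice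
   is immaterial here: replacing phi by its pointwise inverse exchanges the
   two conventions and preserves all the numbers of fixed points. *)
Definition sofic (R : realType) (G : groupType) : Prop :=
  forall (eps : R) (F : {fset G}), 0 < eps -> eps < 1 ->
    exists2 n : nat, (1 <= n)%N & exists phi : G -> 'S_n,
      [/\ (forall e f : G, e \in F -> f \in F ->
             (1 - eps) * n%:R
               <= (nfix (phi e * phi f * (phi (e * f))^-1)%g)%:R),
          phi 1%g = 1%g
        & forall e : G, e \in F -> e != 1%g ->
             (nfix (phi e))%:R <= eps * n%:R].

Section l2.
Context {R : realType}.

Definition sqnormc (z : R[i]) : R := complex.Re z ^+ 2 + complex.Im z ^+ 2.

Lemma sqnormc_ge0 z : 0 <= sqnormc z.
Proof. by rewrite addr_ge0 ?sqr_ge0. Qed.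

Lemma sqnormcM a z : sqnormc (a * z) = sqnormc a * sqnormc z.
Proof. by case: a z => [a b] [c d]; rewrite /sqnormc /=; ring. Qed.

Lemma sqnormcD y z : sqnormc (y + z) <= 2 * (sqnormc y + sqnormc z).
Proof.
case: y z => [a b] [c d]; rewrite /sqnormc /= -subr_ge0.
have -> : 2 * (a ^+ 2 + b ^+ 2 + (c ^+ 2 + d ^+ 2))
    - ((a + c) ^+ 2 + (b + d) ^+ 2) = (a - c) ^+ 2 + (b - d) ^+ 2 by ring.
by rewrite addr_ge0 ?sqr_ge0.
Qed.

Lemma esum_le_scale (T : choiceType) (c : R) (f g : T -> R) : 0 <= c ->
  (forall i, 0 <= f i) -> (forall i, 0 <= g i) ->
  (forall i, f i <= c * g i) ->
  (\esum_(i in setT) (g i)%:E < +oo)%E ->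
  (\esum_(i in setT) (f i)%:E < +oo)%E.
Proof.
move=> c0 f0 g0 fg goo.
have gfin : (\esum_(i in setT) (g i)%:E)%E \is a fin_num.
  by rewrite ge0_fin_numE// esum_ge0// => i _; rewrite lee_fin.
apply: (@le_lt_trans _ _ (c%:E * \esum_(i in setT) (g i)%:E)%E); last first.
  by rewrite -(fineK gfin) -EFinM ltry.
apply: ub_ereal_sup => _ [A fA <-].
apply: (@le_trans _ _ (c%:E * \sum_(i \in A) (g i)%:E)%E).
  rewrite ge0_mule_fsumr; last by move=> i; rewrite lee_fin.
  by apply: lee_fsum => [|i _]; [case: fA | rewrite -EFinM lee_fin].
apply: lee_wpmul2l; first by rewrite lee_fin.
by apply: ereal_sup_ubound; exists A.
Qed.

Variable I : choiceType.

Definition square_summable : {pred I -> R[i]^o} := fun u =>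
  (\esum_(i in [set: I]) (sqnormc (u i))%:E < +oo)%E.

Lemma square_summable_submod_closed : submod_closed square_summable.
Proof.
split=> [|a u v uS vS]; rewrite unfold_in.
  by rewrite esum1// => i _; rewrite /sqnormc /= expr0n addr0.
apply: (@esum_le_scale _ 2 _
  (fun i => sqnormc a * sqnormc (u i) + sqnormc (v i))) => //.
- by move=> i; exact: sqnormc_ge0.
- by move=> i; rewrite addr_ge0 ?mulr_ge0 ?sqnormc_ge0.
- by move=> i; rewrite -sqnormcM; exact: sqnormcD.
have -> : (fun i => (sqnormc a * sqnormc (u i) + sqnormc (v i))%:E) =
    (fun i => (sqnormc a * sqnormc (u i))%:E + (sqnormc (v i))%:E)%E.
  by apply/funext.
rewrite esumD; last 2 first.
  by move=> i _; rewrite lee_fin mulr_ge0 ?sqnormc_ge0.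
  by move=> i _; rewrite lee_fin sqnormc_ge0.
rewrite lte_add_pinfty//.
apply: (@esum_le_scale _ (sqnormc a) _ (fun i => sqnormc (u i))) => //.
- exact: sqnormc_ge0.
- by move=> i; rewrite mulr_ge0 ?sqnormc_ge0.
- by move=> i; exact: sqnormc_ge0.
Qed.

HB.instance Definition _ := GRing.isSubmodClosed.Build _ _ square_summable
  square_summable_submod_closed.

Record l2 : Type :=
  L2 { l2_val :> I -> R[i]^o ; l2_valP : l2_val \in square_summable }.
HB.instance Definition _ := [isSub for l2_val].
HB.instance Definition _ := [Choice of l2 by <:].
HB.instance Definition _ := [SubChoice_isSubLmodule of l2 by <:].

End l2.
Arguments l2 : clear implicits.

Section hilbert_space.
Context {R : realType} {I : choiceType}.
Implicit Types u v : l2 R I.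

(* Unordered sum of an absolutely summable family of real numbers *)
Definition sumr (f : I -> R) : R :=
  fine (\esum_(i in setT) ((EFin \o f)^\+ i))%E
  - fine (\esum_(i in setT) ((EFin \o f)^\- i))%E.

Definition sumc (f : I -> R[i]) : R[i] :=
  Complex (sumr (fun i => complex.Re (f i))) (sumr (fun i => complex.Im (f i))).

Definition dot u v : R[i] := sumc (fun i => u i * conjc (v i)).

Lemma dot0l v : dot 0 v = 0.
Proof.
have E0 : (fun i => (0 : l2 R I) i * conjc (v i)) = (fun=> 0 : R[i]).
  by apply/funext => i; rewrite -[RHS](mul0r (conjc (v i))).
rewrite /dot E0 /sumc /sumr !esum1 ?subrr// => i _.
all: by rewrite ?funeposE ?funenegE /= ?oppr0 maxxx.
Qed.

Lemma basis_vector_subproof (k : I) :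
  (fun i => (i == k)%:R : R[i]^o) \in @square_summable R I.
Proof.
rewrite unfold_in (esumID [set k])//; last first.
  by move=> i _; rewrite lee_fin sqnormc_ge0.
rewrite setTI esum_set1 ?lee_fin ?sqnormc_ge0// esum1 ?adde0 ?ltry//.
move=> i [_ /eqP /negPf ik]; rewrite ik /sqnormc /=.
by rewrite expr0n addr0.
Qed.

Definition basis_vector (k : I) : l2 R I := L2 (basis_vector_subproof k).

Definition selfadjoint (T : l2 R I -> l2 R I) : Prop :=
  forall u v, dot (T u) v = dot u (T v).

(* In R[i], 0 <= z means that z is real and nonnegative. *)
Definition positive (T : l2 R I -> l2 R I) : Prop := forall u, 0 <= dot (T u) u.

(* E is the projection-valued measure of the spectral theorem for T: E A is
   an orthogonal projection for every Borel set A (idempotence is the case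
   A = B of spectral_setI), <E(_) u, u> is a countably additive measure, and
   T = \int t dE(t) in the sense of quadratic forms.  The values of E on
   non-Borel sets are irrelevant. *)
Record is_spectral_measure (T : l2 R I -> l2 R I)
    (E : set R -> l2 R I -> l2 R I) : Prop := {
  spectral_linear : forall A : set (measurableTypeR R), measurable A -> linear (E A) ;
  spectral_selfadjoint : forall A : set (measurableTypeR R), measurable A ->
    selfadjoint (E A) ;
  spectral_setT : forall u, E setT u = u ;
  spectral_setI : forall A B : set (measurableTypeR R),
    measurable A -> measurable B -> forall u, E (A `&` B) u = E A (E B u) ;
  spectral_integral : forall u,
    exists mu : {finite_measure set (measurableTypeR R) -> \bar R},
      [/\ (forall A : set (measurableTypeR R), measurable A ->
             dot (E A u) u = (fine (mu A))%:C%C),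
          mu.-integrable setT (fun t : measurableTypeR R => (t : R)%:E)
        & dot (T u) u = (\int[mu]_t (t : R))%:C%C] }.

(* chi_A(T) = E(A).  By the spectral theorem E exists, and is unique on Borel
   sets, for every bounded self-adjoint T; the default value 0 only serves to
   make chi_A(T) a total function of T. *)
Definition spectral_projection (T : l2 R I -> l2 R I) (A : set R) :
    l2 R I -> l2 R I :=
  xget (fun _ _ => 0) [set E | is_spectral_measure T E] A.

End hilbert_space.

(* The underlying additive group of the integral group ring of G *)
Notation zgroup_ring G := {fsfun G -> int for fun=> 0}.

Section group_ring.
Context {R : realType} {G : groupType} {d : nat}.

(* [l2(G)]^d, as the square-summable families indexed by 'I_d * G *)
Local Notation H := (l2 R ('I_d * G)%type).

(* (A u)_i = \sum_j a_ij u_j, where G acts on l2(G) by left translations: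
   (h v)(g) = v (h^-1 g) *)
Definition mx_act_fun (A : 'M[zgroup_ring G]_d)
    (u : 'I_d * G -> R[i]^o) : 'I_d * G -> R[i]^o := fun k =>
  \sum_(j < d) \sum_(h <- finsupp (A k.1 j))
    (A k.1 j h)%:~R * u (j, h^-1 * k.2)%g.

Definition shift_fun (i j : 'I_d) (h : G) (u : 'I_d * G -> R[i]^o) :
    'I_d * G -> R[i]^o :=
  fun k => if k.1 == i then u (j, h^-1 * k.2)%g else 0.

Lemma shift_fun_summable i j h (u : H) :
  shift_fun i j h u \in @square_summable R ('I_d * G)%type.
Proof.
case: u => u uS /=; move: uS; rewrite !unfold_in; apply: le_lt_trans.
pose D : set ('I_d * G) := [set k | k.1 = i].
pose e (k : 'I_d * G) := (j, h^-1 * k.2)%g.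
have einj : set_inj D e.
  by move=> [k g] [k' g']; rewrite !inE /D/= => -> -> [] /mulgI ->.
apply: (@le_trans _ _ (\esum_(k in D) (sqnormc (u (e k)))%:E)%E).
  rewrite [leRHS]esum_mkcond; apply: le_esum => k _.
  rewrite /shift_fun /e; case: ifPn => [/eqP ki|ki]; first by rewrite mem_set.
  by rewrite memNset ?/sqnormc/= ?expr0n ?addr0// => /= /eqP; rewrite (negPf ki).
rewrite -(esum_image D e (fun k => (sqnormc (u k))%:E))// esum_mkcond.
by apply: le_esum => k _; case: ifP => //; rewrite lee_fin sqnormc_ge0.
Qed.

Lemma mx_act_summable A (u : H) :
  mx_act_fun A u \in @square_summable R ('I_d * G)%type.
Proof.
have -> : mx_act_fun A u = \sum_i \sum_j \sum_(h <- finsupp (A i j))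
    ((A i j h)%:~R : R[i]) *: shift_fun i j h u.
  apply/funext => k; rewrite fct_sumE (bigD1 k.1)//= [X in _ + X]big1 ?addr0.
    rewrite fct_sumE; apply: eq_bigr => j _; rewrite fct_sumE.
    apply: eq_bigr => h _; rewrite -[RHS]/(_ * shift_fun k.1 j h u k).
    by rewrite /shift_fun eqxx.
  move=> i /negPf ik; rewrite fct_sumE big1// => j _; rewrite fct_sumE big1//.
  move=> h _; rewrite -[LHS]/(_ * shift_fun i j h u k).
  by rewrite /shift_fun eq_sym ik mulr0.
apply: rpred_sum => i _; apply: rpred_sum => j _; apply: rpred_sum => h _.
by apply: rpredZ; exact: shift_fun_summable.
Qed.

Definition mx_act A (u : H) : H := L2 (mx_act_summable A u).

Lemma mx_act_is_linear A : linear (mx_act A).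
Proof.
move=> a u v; apply/val_inj/funext => k.
rewrite -[RHS]/((a : R[i]) * mx_act_fun A u k + mx_act_fun A v k).
rewrite /= /mx_act_fun mulr_sumr -big_split/=; apply: eq_bigr => j _.
rewrite mulr_sumr -big_split/=; apply: eq_bigr => h _.
rewrite -[X in _ * X = _]/((a : R[i]) * u (j, h^-1 * k.2)%g
  + v (j, h^-1 * k.2)%g).
by rewrite mulrDr mulrCA.
Qed.
HB.instance Definition _ A := GRing.isLinear.Build _ _ _ _ (mx_act A)
  (mx_act_is_linear A).

(* For A in Mat_d(NG), (A e_i)_i with e_i := basis_vector (i, 1) is the image
   of delta_1 under the diagonal entry a_ii, so that the i-th summand is
   Tr_G(a_ii) = <a_ii delta_1, delta_1>. *)
Definition vN_trace (A : H -> H) : R[i] :=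
  \sum_(i < d) dot (A (basis_vector (i, 1%g))) (basis_vector (i, 1%g)).

Definition spectral_density (T : H -> H) (lambda : R) : R :=
  complex.Re (vN_trace (spectral_projection T `[0, lambda])).

Lemma spectral_densityP (T : H -> H) :
  (exists2 E, is_spectral_measure T E &
     spectral_projection T = E) \/ spectral_projection T = (fun _ _ => 0).
Proof.
rewrite /spectral_projection; case: xgetP => [E _ TE|_]; last by right.
by left; exists E.
Qed.

Lemma finite_measure_itv_nd
    (mu : {finite_measure set (measurableTypeR R) -> \bar R}) :
  nondecreasing (fun x : R => fine (mu `[0, x]%classic)).
Proof.
move=> x y xy; apply: fine_le; rewrite ?fin_num_measure//.
apply: le_measure; rewrite ?inE//.
by apply: subset_itvl; rewrite bnd_simp.
Qed.

Lemma finite_measure_itv_rc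
    (mu : {finite_measure set (measurableTypeR R) -> \bar R}) :
  right_continuous (fun x : R => fine (mu `[0, x]%classic)).
Proof.
move=> a; have nd := finite_measure_itv_nd mu.
pose f (x : R) := fine (mu `[0, x]%classic).
have cf : f x @[x --> a^'+] --> inf (f @` `]a, (a + 1)[).
  apply: nondecreasing_at_right_cvgr.
  - by rewrite ltBSide/= ltrDl.
  - by move=> x y _ _; exact: nd.
  - exists (f a) => y [x]; rewrite /= in_itv/= => /andP[/ltW ax _] <-.
    exact: nd.
have cfn : f (a + n.+1%:R^-1) @[n --> \oo] --> inf (f @` `]a, (a + 1)[).
  move/cvg_at_rightP : cf; apply; split=> [n|]; rewrite ?ltrDl //.
  rewrite -[X in _ --> X]addr0; apply: (@cvgD _ R^o); first exact: cvg_cst.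
  by rewrite gtr0_cvgV0 ?cvg_shiftS; [exact: cvgr_idn | near=> n].
have cfa : f (a + n.+1%:R^-1) @[n --> \oo] --> f a.
  apply: fine_cvg; rewrite fineK ?fin_num_measure//.
  pose F n : set (measurableTypeR R) := `[0, a + n.+1%:R^-1]%classic.
  have <- : \bigcap_n F n = `[0, a]%classic.
    apply/seteqP; split=> x /=; last first.
      rewrite in_itv/= => /andP[x0 xa] n _; rewrite /F/= in_itv/= x0/=.
      by rewrite (le_trans xa)// lerDl.
    move=> Fx; have := Fx 0 I; rewrite /F/= !in_itv/= => /andP[-> _]/=.
    apply/ler_addgt0Pr => e e0; have := Fx (Num.truncn e^-1) I.
    rewrite /F/= in_itv/= => /andP[_ /le_trans]; apply; rewrite lerD2l.
    rewrite invf_ple ?posrE//.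
    exact/ltW/truncnS_gt.
  apply: (@nonincreasing_cvg_mu _ _ _ mu F).
  - by rewrite ltey_eq fin_num_measure//; exact: measurable_itv.
  - by move=> n; exact: measurable_itv.
  - by apply: bigcap_measurable => // n _; exact: measurable_itv.
  - move=> m n mn; apply/subsetPset; apply: subset_itvl.
    by rewrite bnd_simp lerD2l lef_pV2 ?posrE// ler_nat.
by rewrite -[X in _ --> X](cvg_unique _ cfn cfa).
Unshelve. all: by end_near. Qed.

Lemma spectral_densityE (T : H -> H) :
  (exists mu : 'I_d -> {finite_measure set (measurableTypeR R) -> \bar R},
     spectral_density T = (fun x : R => \sum_(i < d) fine (mu i `[0, x]%classic)))
  \/ spectral_density T = (fun=> 0).
Proof.
have ReS (f : 'I_d -> R[i]) :
    complex.Re (\sum_i f i) = \sum_i complex.Re (f i).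
  exact: (raddf_sum (@complex.Re R : Rcomplex R -> R)).
case: (spectral_densityP T) => [[E TE defE]|def0]; [left|right].
  have /choice[mu muP] : forall i : 'I_d,
      exists mu : {finite_measure set (measurableTypeR R) -> \bar R},
      forall A, measurable A -> dot (E A (basis_vector (i, 1%g)))
        (basis_vector (i, 1%g)) = (fine (mu A))%:C%C.
    by move=> i; have [mu [? _ _]] :=
      spectral_integral TE (basis_vector (i, 1%g)); exists mu.
  exists mu; apply/funext => x; rewrite /spectral_density defE /vN_trace ReS.
  by apply: eq_bigr => i _; rewrite muP.
apply/funext => x; rewrite /spectral_density def0 /vN_trace ReS big1// => i _.
by rewrite dot0l.
Qed.

Lemma spectral_density_nd (T : H -> H) : nondecreasing (spectral_density T).
Proof.
have [[mu ->]|->] := spectral_densityE T; last by [].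
by move=> x y xy; apply: ler_sum => i _; exact: finite_measure_itv_nd.
Qed.

Lemma spectral_density_rc (T : H -> H) : right_continuous (spectral_density T).
Proof.
have [[mu ->]|->] := spectral_densityE T; last by move=> a; exact: cvg_cst.
move=> a; elim: (index_enum 'I_d) => [|i s IHs].
  under eq_fun do rewrite big_nil.
  by rewrite big_nil; exact: cvg_cst.
under eq_fun do rewrite big_cons.
rewrite big_cons; apply: (@cvgD _ R^o) => //; exact: finite_measure_itv_rc.
Qed.

HB.instance Definition _ (T : H -> H) := isCumulative.Build R _ R
  (spectral_density T) (@spectral_density_nd T) (@spectral_density_rc T).

(* `]0, +oo[ excludes the atom of dF at 0, as the lower limit 0+ requires. *)
Definition ln_det (T : H -> H) : \bar R :=
  let dF := lebesgue_stieltjes_measure (spectral_density T) in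
  let D : set (measurableTypeR R) := `]0, +oo[%classic in
  if `[< dF.-integrable D (fun x : measurableTypeR R => (ln (x : R))%:E) >]
  then (\int[dF]_(x in D) (ln (x : R))%:E)%E else -oo%E.

End group_ring.

(* Main.v *)
Require Import Defs.
From HB Require Import structures.
From mathcomp Require Import all_boot all_order all_algebra all_fingroup finmap.
From mathcomp Require Import sesquilinear spectral.
From mathcomp Require Import all_classical all_reals all_analysis.
From mathcomp Require Import measurable_realfun complex ring lra.

(** The idea, which goes back to Lueck and to Elek and Szabo: an integer
    symmetric matrix [M] has an integer characteristic polynomial, so that the
    product of its nonzero eigenvalues is a nonzero integer and
    [ln det' M >= 0].  Soficity provides integer symmetric matrices [M] of size
    [d * n] whose moments [tr (M ^+ k) / n] are as close as desired to the
    moments [Tr (Delta^k)], i.e. to those of the spectral measure [nu] of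
    [Delta].  The inequality survives the limit because it can be tested on
    polynomials: with [a = (t / L)^2] in [[0, 1]], the partial sums [P_m] of
    [- ln a = \sum_(j >= 1) (1 - a)^j / j] are polynomials in [t] that increase
    to [- ln a] for [a <> 0] and remain finite at [a = 0], while [(1 - a)^m]
    decreases to the indicator of [a = 0] and controls the multiplicity of the
    eigenvalue [0]. *)

Set Implicit Arguments.
Unset Strict Implicit.
Unset Printing Implicit Defensive.

Import Order.TTheory GRing.Theory Num.Theory.
Import numFieldNormedType.Exports.

Local Open Scope classical_set_scope.
Local Open Scope ring_scope.

(** * Absolutely summable families *)

(** The finite models need not be positive, although [Delta] is; the square in [(t / L)^2] keeps the
    argument of the logarithm in [[0, 1]] on their spectra as well. With [c = ln (L^2)] one has
    [- ln a = c - 2 ln |t|], so that [ln det' >= 0] bounds from above the sum of [- ln a] over the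
    nonzero eigenvalues. A zero eigenvalue contributes [P_M(0)] instead, and the number of zero
    eigenvalues is not a continuous function of the moments; it is replaced by the larger sum of the
    [(1 - a)^m]. When [P_M(0) >= c], this gives for fixed [M] and [m] an inequality that is linear
    in finitely many moments. Hence the order of the limits: the models, then [m], then [M]. A
    second obstacle is that a spectral measure is tied to its operator by the first moment alone,
    [<T u, u> = \int t dmu]. The higher moments are recovered by comparing [T] with finite
    combinations of its spectral projections. *)

Section sumr.
Context {R : realType} {I : choiceType}.
Implicit Types f g : I -> R.

Lemma esumZl (c : R) f : 0 <= c -> (forall i, 0 <= f i) ->
  (\esum_(i in setT) (c * f i)%:E = c%:E * \esum_(i in setT) (f i)%:E)%E.
Proof.
move=> c0 f0; rewrite /esum -ereal_supZl//; last first.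
  by apply/set0P; exists 0%E; exists set0; rewrite ?fsbig_set0//; split.
congr ereal_sup; rewrite image_comp; apply: eq_imagel => A [fA _] /=.
rewrite ge0_mule_fsumr; last by move=> i; rewrite lee_fin.
by apply: eq_fsbigr => i _; rewrite EFinM.
Qed.

Definition rsummable f := summable setT (EFin \o f).

Lemma rsummableD f g : rsummable f -> rsummable g -> rsummable (f \+ g).
Proof. exact: summableD. Qed.

Lemma rsummable_le f g : (forall i, `|f i| <= g i) -> rsummable g -> rsummable f.
Proof.
move=> fg; apply: le_lt_trans; apply: le_esum => i _ /=.
by rewrite lee_fin (le_trans (fg i))// ler_norm.
Qed.

Lemma rsummableZ c f : rsummable f -> rsummable (fun i => c * f i).
Proof.
rewrite /rsummable /summable => fs.
rewrite (_ : (\esum_(_ in _) _)%E = (`|c|%:E * \esum_(i in setT) `|f i|%:E)%E).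
  have fin : (\esum_(i in setT) `|f i|%:E)%E \is a fin_num.
    by rewrite ge0_fin_numE// esum_ge0// => i _; rewrite lee_fin.
  by rewrite -(fineK fin) -EFinM ltry.
rewrite -esumZl//; apply: eq_esum => i _ /=.
by rewrite normrM.
Qed.

Let fins f : rsummable f -> (forall i, 0 <= f i) ->
    (\esum_(i in setT) (f i)%:E)%E \is a fin_num.
Proof.
move=> hs h0; rewrite ge0_fin_numE ?esum_ge0// => [|i _]; last by rewrite lee_fin.
move: hs; rewrite /rsummable /summable; congr (_ < _)%E; apply: eq_esum => i _ /=.
by rewrite ger0_norm.
Qed.

(** Independence of the decomposition: [sumr] is defined by positive and negative parts, which are
    not additive, whereas any difference of nonnegative summable families is allowed here. Linearity
    of [sumr] follows. *)
Lemma sumrE f g : rsummable f -> rsummable g -> (forall i, 0 <= f i) ->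
  (forall i, 0 <= g i) ->
  sumr (f \- g) =
    fine (\esum_(i in setT) (f i)%:E)%E - fine (\esum_(i in setT) (g i)%:E)%E.
Proof.
move=> fs gs f0 g0.
have finp h : rsummable h -> (\esum_(i in setT) (EFin \o h)^\+ i)%E \is a fin_num.
  move=> /summable_funepos; rewrite /summable ge0_fin_numE ?esum_ge0//.
  by under eq_esum do rewrite gee0_abs//.
have finn h : rsummable h -> (\esum_(i in setT) (EFin \o h)^\- i)%E \is a fin_num.
  move=> /summable_funeneg; rewrite /summable ge0_fin_numE ?esum_ge0//.
  by under eq_esum do rewrite gee0_abs//.
have fgs : rsummable (f \- g).
  exact: (@summableB _ _ setT (EFin \o f) (EFin \o g)).
rewrite /sumr -!fineB ?fins ?finp ?finn//; congr fine.
by rewrite -(@esumB _ _ setT (EFin \o f) (EFin \o g))// => i _; rewrite lee_fin.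
Qed.

Lemma sumr_ge0E f : rsummable f -> (forall i, 0 <= f i) ->
  sumr f = fine (\esum_(i in setT) (f i)%:E)%E.
Proof.
move=> fs f0; have z0 : rsummable (fun=> 0 : R).
  by rewrite /rsummable /summable esum1// => i _ /=; rewrite normr0.
have := sumrE fs z0 f0 (fun=> lexx 0).
rewrite [X in _ - fine X]esum1// subr0 => <-; congr sumr; apply/funext => i /=.
by rewrite subr0.
Qed.

Let pos f i := Num.max (f i) 0.
Let neg f i := Num.max (- f i) 0.
Let pos0 f i : 0 <= pos f i. Proof. by rewrite le_max lexx orbT. Qed.
Let neg0 f i : 0 <= neg f i. Proof. by rewrite le_max lexx orbT. Qed.
Let posneg f : f = pos f \- neg f.
Proof. by apply/funext => i; rewrite /pos /neg /= !maxEle; do 2 case: ifPn; lra. Qed.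
Let poss f : rsummable f -> rsummable (pos f).
Proof.
apply: le_lt_trans; apply: le_esum => i _; rewrite /= lee_fin ger0_norm//.
by rewrite ge_max ler_norm normr_ge0.
Qed.
Let negs f : rsummable f -> rsummable (neg f).
Proof.
apply: le_lt_trans; apply: le_esum => i _; rewrite /= lee_fin ger0_norm//.
by rewrite ge_max -normrN ler_norm normr_ge0.
Qed.
Let sumr_posneg f : rsummable f ->
  sumr f = fine (\esum_(i in setT) (pos f i)%:E)%E
    - fine (\esum_(i in setT) (neg f i)%:E)%E.
Proof.
by move=> fs; rewrite {1}(posneg f) sumrE//; [exact: poss|exact: negs].
Qed.

Lemma sumrD f g : rsummable f -> rsummable g -> sumr (f \+ g) = sumr f + sumr g.
Proof.
move=> fs gs.
rewrite (_ : f \+ g = (pos f \+ pos g) \- (neg f \+ neg g)); last first.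
  apply/funext => i /=; rewrite [in LHS](posneg f) [in LHS](posneg g) /=; lra.
rewrite sumrE; last 4 first.
  - by apply: rsummableD; exact: poss.
  - by apply: rsummableD; exact: negs.
  - by move=> i; rewrite addr_ge0.
  - by move=> i; rewrite addr_ge0.
under eq_esum do rewrite EFinD.
under [X in _ - fine X]eq_esum do rewrite EFinD.
rewrite !sumr_posneg//.
rewrite !esumD//; try by move=> i _; rewrite lee_fin.
rewrite !fineD ?fins//; try exact: poss; try exact: negs.
lra.
Qed.

Lemma sumrZ c f : rsummable f -> sumr (fun i => c * f i) = c * sumr f.
Proof.
move=> fs; wlog c0 : c / 0 <= c => [H|].
  have [/H//|c0] := leP 0 c.
  have cN : 0 <= - c by rewrite oppr_ge0 ltW.
  have := sumrD (rsummableZ c fs) (rsummableZ (- c) fs).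
  rewrite (H _ cN) mulNr => /eqP; rewrite eq_sym subr_eq => /eqP ->.
  rewrite [X in sumr X](_ : _ = fun=> 0); last first.
    by apply/funext => i /=; rewrite mulNr subrr.
  rewrite sumr_ge0E//; last first.
    by rewrite /rsummable /summable esum1// => i _ /=; rewrite normr0.
  by rewrite esum1// add0r.
rewrite (_ : (fun i => c * f i) =
    (fun i => c * pos f i) \- (fun i => c * neg f i)); last first.
  by apply/funext => i /=; rewrite [in LHS](posneg f) /= mulrBr.
rewrite sumrE; last 4 first.
  - exact/rsummableZ/poss.
  - exact/rsummableZ/negs.
  - by move=> i; rewrite mulr_ge0.
  - by move=> i; rewrite mulr_ge0.
rewrite !esumZl// sumr_posneg//.
by rewrite mulrBr !fineM// fins//; do ?[exact: poss|exact: negs].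
Qed.

Lemma ge0_sumr f : rsummable f -> (forall i, 0 <= f i) -> 0 <= sumr f.
Proof.
by move=> fs f0; rewrite sumr_ge0E// fine_ge0// esum_ge0// => i _; rewrite lee_fin.
Qed.

Lemma sumr_single f k : (forall i, i != k -> f i = 0) -> sumr f = f k.
Proof.
move=> fk.
have es (g : I -> R) : (forall i, i != k -> g i = 0) -> (forall i, 0 <= g i) ->
    (\esum_(i in setT) (g i)%:E = (g k)%:E)%E.
  move=> gk g0; rewrite (esumID [set k])//; last by move=> i _; rewrite lee_fin.
  rewrite setTI esum_set1 ?lee_fin// esum1 ?adde0//.
  by move=> i [_ /= /eqP ik]; rewrite gk.
have fs (g : I -> R) : (forall i, i != k -> g i = 0) -> (forall i, 0 <= g i) -> rsummable g.
  move=> gk g0; rewrite /rsummable /summable.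
  rewrite (_ : (\esum_(_ in _) _)%E = (g k)%:E) ?ltry// -es//; apply: eq_esum => i _ /=.
  by rewrite ger0_norm.
have pk i : i != k -> pos f i = 0 by move=> ik; rewrite /pos fk ?maxxx.
have nk i : i != k -> neg f i = 0 by move=> ik; rewrite /neg fk ?oppr0 ?maxxx.
rewrite {1}(posneg f) sumrE ?es ?fs//=.
by rewrite [RHS](congr1 (@^~ k) (posneg f)).
Qed.
End sumr.

(** * The real inner product of l2 *)

Section rdot.
Context {R : realType} {I : choiceType}.
Implicit Types (u v w : l2 R I) (a : R).

Let rmul (y z : R[i]) : R := complex.Re y * complex.Re z + complex.Im y * complex.Im z.

(** The forms of self-adjoint operators are real and only real scalars occur below, so [l2] is
    treated as a real inner product space. *)
Definition rdot u v : R := complex.Re (dot u v).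

Let rdotE u v : rdot u v = sumr (fun i => rmul (u i) (v i)).
Proof.
rewrite /rdot /dot /sumc /=; congr sumr; apply/funext => i.
by case: (u i) (v i) => [a b] [c d]; rewrite /rmul /=; ring.
Qed.

Let rmul_le y z : `|rmul y z| <= (sqnormc y + sqnormc z) / 2.
Proof.
case: y z => [a b] [c d]; rewrite /rmul /sqnormc /= ler_norml; apply/andP; split.
  have := sqr_ge0 (a + c); have := sqr_ge0 (b + d); rewrite !sqrrD; lra.
have := sqr_ge0 (a - c); have := sqr_ge0 (b - d); rewrite !sqrrB; lra.
Qed.

Let sqs u : rsummable (fun i => sqnormc (u i)).
Proof.
have := l2_valP u; rewrite unfold_in /rsummable /summable.
congr (_ < _)%E; apply: eq_esum => i _ /=.
by rewrite ger0_norm ?sqnormc_ge0.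
Qed.

Let rmuls u v : rsummable (fun i => rmul (u i) (v i)).
Proof.
apply: rsummable_le (fun i => rmul_le (u i) (v i)) _.
rewrite (_ : (fun i => _) = (fun i => 2^-1 * (sqnormc (u i) + sqnormc (v i)))).
  by apply/rsummableZ/rsummableD; exact: sqs.
by apply/funext => i; rewrite mulrC.
Qed.

Lemma rdotC u v : rdot u v = rdot v u.
Proof.
rewrite !rdotE; congr sumr; apply/funext => i.
by rewrite /rmul mulrC [X in _ + X]mulrC.
Qed.

Lemma rdotDl u v w : rdot (u + v) w = rdot u w + rdot v w.
Proof.
rewrite !rdotE -sumrD; [|exact: rmuls|exact: rmuls].
congr sumr; apply/funext => i.
rewrite -[(u + v) i]/((u i : R[i]) + v i) /rmul /=.
by case: (u i) (v i) => [a b] [c d] /=; ring.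
Qed.

Lemma rdotZl a u w : rdot (a%:C%C *: u) w = a * rdot u w.
Proof.
rewrite !rdotE -sumrZ; last exact: rmuls.
congr sumr; apply/funext => i.
rewrite -[(a%:C%C *: u) i]/((a%:C%C : R[i]) * u i) /rmul /=.
by case: (u i) => [b c] /=; ring.
Qed.

Lemma rdotDr u v w : rdot w (u + v) = rdot w u + rdot w v.
Proof. by rewrite rdotC rdotDl !(rdotC w). Qed.

Lemma rdotZr a u w : rdot w (a%:C%C *: u) = a * rdot w u.
Proof. by rewrite rdotC rdotZl (rdotC w). Qed.

Lemma rdotNl u w : rdot (- u) w = - rdot u w.
Proof. by rewrite -scaleN1r -(rmorphN1 (real_complex R)) rdotZl mulN1r. Qed.

Lemma rdotNr u w : rdot w (- u) = - rdot w u.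
Proof. by rewrite rdotC rdotNl (rdotC w). Qed.

Lemma rdot0l w : rdot 0 w = 0.
Proof. by rewrite -(subrr w) rdotDl rdotNl subrr. Qed.

Lemma rdot_suml (J : Type) (r : seq J) (P : pred J) (f : J -> l2 R I) w :
  rdot (\sum_(j <- r | P j) f j) w = \sum_(j <- r | P j) rdot (f j) w.
Proof.
by apply: (big_morph (rdot^~ w)) => [u v|]; [exact: rdotDl | exact: rdot0l].
Qed.

Lemma esum_sqnormc_fin u : (\esum_(i in setT) (sqnormc (u i))%:E)%E \is a fin_num.
Proof.
rewrite ge0_fin_numE; first by have := l2_valP u; rewrite unfold_in.
by apply: esum_ge0 => i _; rewrite lee_fin sqnormc_ge0.
Qed.

Definition sqnorm u := rdot u u.

Lemma sqnormE u : sqnorm u = sumr (fun i => sqnormc (u i)).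
Proof. by rewrite /sqnorm rdotE; congr sumr; apply/funext => i; rewrite /rmul -!expr2. Qed.

Lemma sqnorm_esum u : sqnorm u = fine (\esum_(i in setT) (sqnormc (u i))%:E)%E.
Proof. by rewrite sqnormE sumr_ge0E; [| exact: sqs | move=> i; exact: sqnormc_ge0]. Qed.

Lemma sqnorm_ge0 u : 0 <= sqnorm u.
Proof. rewrite sqnormE; apply: ge0_sumr => [|i]; [exact: sqs|exact: sqnormc_ge0]. Qed.

Lemma sqnormD_le u v : sqnorm (u + v) <= 2 * (sqnorm u + sqnorm v).
Proof.
have := sqnorm_ge0 (u - v); rewrite /sqnorm !(rdotDl, rdotDr, rdotNl, rdotNr).
by rewrite (rdotC v u); lra.
Qed.

Lemma sqnormZ a u : sqnorm (a%:C%C *: u) = a ^+ 2 * sqnorm u.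
Proof. by rewrite /sqnorm rdotZl rdotZr mulrA. Qed.

(** Cauchy-Schwarz in weighted arithmetic-geometric form, from the square norm of [a u - b v] with
    [b = 1] or [b = -1]. It avoids square roots and leaves the weight free to balance vectors of
    different sizes. *)
Lemma norm_rdot_le a u v : 0 < a ->
  `|rdot u v| <= (a * sqnorm u + a^-1 * sqnorm v) / 2.
Proof.
move=> a0; have an0 : a != 0 by rewrite gt_eqF.
have H b : (b = 1 \/ b = -1) -> b * rdot u v <= (a * sqnorm u + a^-1 * sqnorm v) / 2.
  move=> bP; have := sqnorm_ge0 (a%:C%C *: u - b%:C%C *: v).
  rewrite /sqnorm !(rdotDl, rdotDr, rdotNl, rdotNr, rdotZl, rdotZr) (rdotC v u) => H.
  rewrite -(ler_pM2l a0).
  have -> : a * ((a * sqnorm u + a^-1 * sqnorm v) / 2) = (a * (a * sqnorm u) + sqnorm v) / 2.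
    by field.
  by case: bP H => ->; rewrite /sqnorm; lra.
rewrite ler_norml; apply/andP; split.
  by have := H (-1) (or_intror erefl); lra.
by have := H 1 (or_introl erefl); lra.
Qed.

Lemma rdot_basis u k : rdot u (basis_vector k) = complex.Re (u k).
Proof.
rewrite rdotE (sumr_single (k := k)).
  by rewrite /rmul /= eqxx /=; ring.
by move=> i /negPf ik; rewrite /rmul /= ik /=; ring.
Qed.

(* Polarization: for symmetric [X] the quadratic form controls the norm. *)
Lemma sqnorm_quadratic_form (X : l2 R I -> l2 R I) (del : R) : 0 < del ->
  {morph X : u v / u + v} -> (forall a, {morph X : u / a%:C%C *: u}) ->
  (forall u v, rdot (X u) v = rdot u (X v)) ->
  (forall u, `|rdot (X u) u| <= del * sqnorm u) ->
  forall u, sqnorm (X u) <= del ^+ 2 * sqnorm u.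
Proof.
(* With this scaling, polarization and the parallelogram law give
   [4 |X u|^2 <= 2 del^2 |u|^2 + 2 |X u|^2], and the last term is absorbed on the left. *)
move=> d0 XD XZ Xs Xq u; pose v := (del^-1)%:C%C *: X u.
have XN w : X (- w) = - X w.
  by rewrite -scaleN1r -(rmorphN1 (real_complex R)) XZ rmorphN1 scaleN1r.
have := Xq (u + v); have := Xq (u - v).
rewrite !ler_norml => /andP[H1 _] /andP[_ H2].
have : rdot (X (u + v)) (u + v) - rdot (X (u - v)) (u - v) = 4 * rdot (X u) v.
  rewrite !(XD, XN, rdotDl, rdotDr, rdotNl, rdotNr) (Xs v u) (rdotC v); ring.
have : sqnorm (u + v) + sqnorm (u - v) = 2 * (sqnorm u + sqnorm v).
  rewrite /sqnorm !(rdotDl, rdotDr, rdotNl, rdotNr); ring.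
rewrite {3}/v rdotZr -/(sqnorm (X u)) => E1 E2.
have dn0 : del != 0 by rewrite gt_eqF.
have E3 : sqnorm v = del^-1 ^+ 2 * sqnorm (X u) by rewrite sqnormZ.
have : 4 * (del^-1 * sqnorm (X u)) <= del * (2 * (sqnorm u + sqnorm v)).
  by rewrite -E1 -E2 mulrDr; lra.
rewrite E3 => H.
have {}H : del * (4 * (del^-1 * sqnorm (X u))) <= 
   del * (del * (2 * (sqnorm u + del^-1 ^+ 2 * sqnorm (X u)))).
  by rewrite ler_pM2l.
have e1 : del * (4 * (del^-1 * sqnorm (X u))) = 4 * sqnorm (X u) by field.
have e2 : del * (del * (2 * (sqnorm u + del^-1 ^+ 2 * sqnorm (X u)))) =
  2 * (del ^+ 2 * sqnorm u) + 2 * sqnorm (X u) by field.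
by move: H; rewrite e1 e2; lra.
Qed.
End rdot.

(** * Support and moments of a spectral measure *)

Section finite_measure_R.
Context {R : realType} (mu : {finite_measure set (measurableTypeR R) -> \bar R}).

Lemma fine_measureU (A B : set (measurableTypeR R)) : measurable A -> measurable B ->
  [disjoint A & B] -> fine (mu (A `|` B)) = fine (mu A) + fine (mu B).
Proof.
by move=> mA mB /disj_set2P AB; rewrite measureU// fineD ?fin_num_measure.
Qed.

Lemma Rintegral_null_compl (A : set (measurableTypeR R)) (f : measurableTypeR R -> R) :
  measurable A -> mu.-integrable setT (EFin \o f) -> fine (mu (~` A)) = 0 ->
  \int[mu]_t f t = \int[mu]_(t in A) f t.
Proof.
move=> mA fi A0; rewrite -(setUv A) Rintegral_setU ?setUv//; last 2 first.
- exact: measurableC.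
- by apply/disj_setPS; rewrite setICr.
rewrite [X in _ + X](_ : _ = 0) ?addr0//.
rewrite /Rintegral null_set_integral//.
- exact: measurableC.
- by apply: (measurable_funS measurableT) => //; exact: measurable_int fi.
- by rewrite -[LHS]fineK ?fin_num_measure ?A0//; exact: measurableC.
Qed.

Lemma integrable_bounded (A : set (measurableTypeR R))
    (f : measurableTypeR R -> R) (C : R) :
  measurable A -> measurable_fun A f -> (forall t, A t -> `|f t| <= C) ->
  mu.-integrable A (EFin \o f).
Proof.
move=> mA mf fC; apply: measurable_bounded_integrable => //.
  by rewrite ltey_eq fin_num_measure.
exists C; split; first exact: num_real.
by move=> M CM x Ax; exact: le_trans (fC x Ax) (ltW CM).
Qed.

Lemma dist_Rintegral_cst (A : set (measurableTypeR R))
    (f : measurableTypeR R -> R) (c e : R) :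
  measurable A -> mu.-integrable A (EFin \o f) ->
  (forall t, A t -> `|f t - c| <= e) ->
  `|\int[mu]_(t in A) f t - c * fine (mu A)| <= e * fine (mu A).
Proof.
move=> mA fi fc.
have ci (r : R) : mu.-integrable A (EFin \o cst r) by exact: finite_measure_integrable_cst.
rewrite -!Rintegral_cst// -RintegralB//; last exact: ci.
have fci : mu.-integrable A (EFin \o (fun x => f x - c)).
  by have := integrableB mA fi (ci c).
apply: (le_trans (le_normr_Rintegral mA fci)).
by apply: le_Rintegral => //; [exact: integrable_norm|exact: ci].
Qed.

(** A Riemann sum estimate: on each cell the error is at most [e] times the mass of the cell, and
    half-open cells are disjoint. It serves for [t] and for its powers. *)
Lemma dist_Rintegral_step (x : nat -> R) (f : measurableTypeR R -> R)
    (c : nat -> R) (e : R) n :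
  {homo x : i j / (i <= j)%N >-> i <= j} ->
  mu.-integrable `[x 0%N, x n[ (EFin \o f) ->
  (forall k t, (k < n)%N -> t \in `[x k, x k.+1[ -> `|f t - c k| <= e) ->
  `|\int[mu]_(t in `[x 0%N, x n[) f t - \sum_(k < n) c k * fine (mu `[x k, x k.+1[%classic)|
    <= e * fine (mu `[x 0%N, x n[%classic).
Proof.
move=> xh; elim: n => [|n IH] fi fc.
  by rewrite set_itvco0 Rintegral_set0 big_ord0 subr0 normr0 measure0 mulr0.
have sE : `[x 0%N, x n.+1[%classic = `[x 0%N, x n[%classic `|` `[x n, x n.+1[%classic.
  by apply: itv_bndbnd_setU; rewrite bnd_simp xh.
have dj : [disjoint `[x 0%N, x n[%classic & `[x n, x n.+1[%classic].
  apply/disj_setPS => t [/=]; rewrite !in_itv/= => /andP[_ tx] /andP[].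
  by rewrite leNgt tx.
have fi1 : mu.-integrable `[x 0%N, x n[ (EFin \o f).
  by apply: integrableS fi => //; [rewrite sE; exact: subsetUl].
have fi2 : mu.-integrable `[x n, x n.+1[ (EFin \o f).
  by apply: integrableS fi => //; [rewrite sE; exact: subsetUr].
rewrite big_ord_recr/= sE Rintegral_setU//; last by rewrite -sE.
rewrite fine_measureU// opprD addrACA mulrDr (le_trans (ler_normD _ _))// lerD//.
  by apply: IH => // k t kn tk; exact: (fc k t (leqW kn) tk).
apply: dist_Rintegral_cst => //.
by move=> t tn; exact: (fc n t (ltnSn n) tn).
Qed.
End finite_measure_R.

Section definite.
Context {R : realType} {I : choiceType}.
Implicit Types u : l2 R I.

Lemma sqnorm_eq0 u : sqnorm u = 0 -> u = 0.
Proof.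
move=> u0; apply/val_inj/funext => k /=.
have uk : ((sqnormc (u k))%:E <= \esum_(i in setT) (sqnormc (u i))%:E)%E.
  by apply: esum_ge; exists [set k]; rewrite ?fsbig_set1//; split.
move: u0; rewrite sqnorm_esum => u0; move: uk; rewrite -(fineK (esum_sqnormc_fin u)) u0 lee_fin.
rewrite /sqnormc => uk.
have := sqr_ge0 (complex.Re (u k)); have := sqr_ge0 (complex.Im (u k)) => i0 r0.
have /eqP : complex.Re (u k) ^+ 2 = 0 by apply/le_anti/andP; split; lra.
have /eqP : complex.Im (u k) ^+ 2 = 0 by apply/le_anti/andP; split; lra.
rewrite !sqrf_eq0 => /eqP i1 /eqP r1.
by rewrite -[LHS]/(u k) [LHS]complexE r1 i1 mulr0 addr0.
Qed.
End definite.

(** * Spectral measures of bounded positive operators *)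

Section spectral_measure.
Context {R : realType} {I : choiceType}.
Variables (T : l2 R I -> l2 R I) (E : set R -> l2 R I -> l2 R I) (K : nat).
Hypothesis TE : is_spectral_measure T E.
Hypothesis TD : {morph T : u v / u + v}.
Hypothesis TZ : forall a : R, {morph T : u / a%:C%C *: u}.
Hypothesis Ts : selfadjoint T.
Hypothesis Tpos : positive T.
Hypothesis TK : forall u, `|rdot (T u) u| <= K%:R * sqnorm u.
Implicit Types (u v : l2 R I) (A : set (measurableTypeR R)).

(** The strict excess of [L] over the bound [K] leaves no room for mass in [[L, +oo[], including at
    the endpoint excluded from [D]. *)
Local Notation L := (K.+1%:R : R).
Local Notation D := (`[0, L[%classic : set (measurableTypeR R)).
Let mD : measurable D. Proof. exact: measurable_itv. Qed.

Let ED A : measurable A -> {morph E A : u v / u + v}.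
Proof. by move=> mA u v; have := spectral_linear TE mA 1 u v; rewrite !scale1r. Qed.

Let E0 A : measurable A -> E A 0 = 0.
Proof. by move=> mA; apply/(addrI (E A 0)); rewrite -ED// !addr0. Qed.

Let EZ A (a : R) : measurable A -> {morph E A : u / a%:C%C *: u}.
Proof. by move=> mA u; have := spectral_linear TE mA a%:C%C u 0; rewrite !(addr0, E0). Qed.

Let Es A u v : measurable A -> rdot (E A u) v = rdot u (E A v).
Proof. by move=> mA; rewrite /rdot (spectral_selfadjoint TE). Qed.

Let Eid A u : measurable A -> E A (E A u) = E A u.
Proof. by move=> mA; rewrite -(spectral_setI TE)// setIid. Qed.

Let measure_of u : exists mu : {finite_measure set (measurableTypeR R) -> \bar R},
  [/\ forall A, measurable A -> rdot (E A u) u = fine (mu A),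
      mu.-integrable setT (fun t : measurableTypeR R => (t : R)%:E)
    & rdot (T u) u = \int[mu]_t (t : R)].
Proof.
have [mu [H1 H2 H3]] := spectral_integral TE u; exists mu; split => //.
  by move=> A mA; rewrite /rdot H1.
by rewrite /rdot H3.
Qed.

Let sqnormEA A u : measurable A -> sqnorm (E A u) = rdot (E A u) u.
Proof. by move=> mA; rewrite /sqnorm -Es// Eid// . Qed.

Let Eset0 u : E set0 u = 0.
Proof.
apply: sqnorm_eq0; rewrite sqnormEA//.
by have [mu [-> // _ _]] := measure_of u; rewrite measure0.
Qed.

Let EC A u : measurable A -> E (~` A) (E A u) = 0.
Proof. by move=> mA; rewrite -(spectral_setI TE) ?setICl//; exact: measurableC. Qed.

(* The measure of [E A u] is concentrated on [A]. *)
Let E_integral A u : measurable A ->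
  exists mu : {finite_measure set (measurableTypeR R) -> \bar R},
  [/\ mu.-integrable A (fun t : measurableTypeR R => (t : R)%:E),
   fine (mu A) = sqnorm (E A u) &
   rdot (T (E A u)) (E A u) = \int[mu]_(t in A) (t : R)].
Proof.
move=> mA; have [mu [muE mui muT]] := measure_of (E A u); exists mu; split.
- by apply: (integrableS measurableT).
- by rewrite -muE// Eid.
- rewrite muT; apply: Rintegral_null_compl => //.
  by rewrite -muE ?EC ?rdot0l//; exact: measurableC.
Qed.

Let E_ge A u (a : R) : measurable A -> (forall t, A t -> a <= t) ->
  a * sqnorm (E A u) <= rdot (T (E A u)) (E A u).
Proof.
move=> mA Aa; have [mu [mui <- ->]] := E_integral u mA.
rewrite -!Rintegral_cst//; apply: le_Rintegral => //.
exact: finite_measure_integrable_cst.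
Qed.

Let E_le A u (b : R) : measurable A -> (forall t, A t -> t <= b) ->
  rdot (T (E A u)) (E A u) <= b * sqnorm (E A u).
Proof.
move=> mA Ab; have [mu [mui <- ->]] := E_integral u mA.
rewrite -!Rintegral_cst//; apply: le_Rintegral => //.
exact: finite_measure_integrable_cst.
Qed.

(** On the range of this projection the form of [T] is at least [L |v|^2] by [E_ge], but at most
    [K |v|^2] by [TK]. *)
Let spec_large u : E `[L, +oo[%classic u = 0.
Proof.
apply: sqnorm_eq0; apply/le_anti; rewrite sqnorm_ge0 andbT.
set A : set (measurableTypeR R) := `[L, +oo[%classic.
have mA : measurable A by exact: measurable_itv.
have := @E_ge A u L mA; move=> /(_ _)/le_trans H.
have := TK (E A u); rewrite ler_norml => /andP[_ /H].
have /[swap]/[apply] : forall t, A t -> L <= t by move=> t; rewrite /A/= in_itv/= andbT.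
by rewrite -addn1 natrD; lra.
Qed.

(** Positivity contradicts [<T v, v> <= - |v|^2 / (n + 1)] unless [v = 0]. The gap below [0] makes
    the contradiction strict; []-oo, 0[] is the countable union of these half-lines. *)
Let spec_neg_lt u n : E `]-oo, - n.+1%:R^-1]%classic u = 0.
Proof.
apply: sqnorm_eq0; apply/le_anti; rewrite sqnorm_ge0 andbT.
set A : set (measurableTypeR R) := `]-oo, - n.+1%:R^-1]%classic.
have mA : measurable A by exact: measurable_itv.
have := @E_le A u (- n.+1%:R^-1) mA; move=> /(_ _) H.
have H1 : 0 <= rdot (T (E A u)) (E A u).
  by have := Tpos (E A u); rewrite lecE => /andP[].
have h : forall t, A t -> t <= - n.+1%:R^-1 by move=> t; rewrite /A/= in_itv.
have := le_trans H1 (H h); rewrite mulNr oppr_ge0 pmulr_rle0// invr_gt0.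
Qed.

Lemma spectral_support u (mu : {finite_measure set (measurableTypeR R) -> \bar R}) :
  (forall A, measurable A -> rdot (E A u) u = fine (mu A)) -> mu (~` D) = 0%E.
Proof.
move=> muE.
have mu0 A : measurable A -> E A u = 0 -> mu A = 0%E.
  by move=> mA A0; rewrite -[LHS]fineK ?fin_num_measure// -muE// A0 rdot0l.
pose F n : set (measurableTypeR R) := `]-oo, - n.+1%:R^-1]%classic.
have -> : ~` D = (\bigcup_n F n) `|` `[L, +oo[%classic.
  apply/seteqP; split => t.
    rewrite /= in_itv/= => /negP; rewrite negb_and -ltNge -leNgt.
    case/orP => tL; last by right; rewrite in_itv/= andbT.
    left; have t0 : 0 < - t by rewrite oppr_gt0.
    exists (Num.truncn (- t)^-1) => //; rewrite /F/= in_itv/= lerNr.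
    rewrite invf_ple ?posrE//; exact/ltW/truncnS_gt.
  move=> [[n _]|]; rewrite /F /= !in_itv/= ?andbT => H /andP[t0 tL].
    have := le_trans t0 H; rewrite oppr_ge0 leNgt invr_gt0 ltr0Sn//.
  by move: tL; rewrite ltNge H.
apply/negligibleP.
  apply: measurableU; last exact: measurable_itv.
  by apply: bigcup_measurable => n _; exact: measurable_itv.
apply: negligibleU.
  apply: negligible_bigcup => n; apply/negligibleP; first exact: measurable_itv.
  by apply: mu0; [exact: measurable_itv|exact: spec_neg_lt].
by apply/negligibleP; [|apply: mu0]; [exact: measurable_itv..|exact: spec_large].
Qed.

Let fine_measureD u (mu : {finite_measure set (measurableTypeR R) -> \bar R}) :
  (forall A, measurable A -> rdot (E A u) u = fine (mu A)) ->
  fine (mu D) = sqnorm u.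
Proof.
move=> muE; have := muE setT measurableT.
rewrite (spectral_setT TE) -/(sqnorm u) => ->.
rewrite -(setUv D) fine_measureU ?(spectral_support muE) ?addr0//.
  exact: measurableC.
by apply/disj_set2P; rewrite setICr.
Qed.

Let measureD u : exists mu : {finite_measure set (measurableTypeR R) -> \bar R},
  [/\ forall A, measurable A -> rdot (E A u) u = fine (mu A), mu (~` D) = 0%E,
    fine (mu D) = sqnorm u & rdot (T u) u = \int[mu]_(t in D) (t : R)].
Proof.
have [mu [muE mui muT]] := measure_of u.
have mu0 := spectral_support muE; exists mu; split => //.
- exact: fine_measureD.
- by rewrite muT; apply: Rintegral_null_compl => //; rewrite mu0.
Qed.

Section step.
Variable p : nat.
Hypothesis p0 : (0 < p)%N.

(** A grid of mesh [1 / p]; since [x n = L], its [n] cells partition [D] exactly. *)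
Let x (k : nat) : R := k%:R / p%:R.
Let n := (K.+1 * p)%N.
Let Ak (k : nat) : set (measurableTypeR R) := `[x k, x k.+1[%classic.
Let mAk k : measurable (Ak k). Proof. exact: measurable_itv. Qed.
Let pR : 0 < p%:R :> R. Proof. by rewrite ltr0n. Qed.
Let xh : {homo x : i j / (i <= j)%N >-> i <= j}.
Proof. by move=> i j ij; rewrite /x ler_pM2r ?invr_gt0// ler_nat. Qed.
Let DE : D = `[x 0%N, x n[%classic.
Proof. by rewrite /x /n mul0r natrM mulfK// gt_eqF. Qed.
Let xS k t : t \in `[x k, x k.+1[ -> `|t - x k| <= p%:R^-1.
Proof.
rewrite in_itv/= => /andP[kt tk]; rewrite ger0_norm ?subr_ge0//.
rewrite lerBlDl (le_trans (ltW tk))// /x -addn1 natrD mulrDl mul1r//.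
Qed.

(* [step_op] is within [1 / p] of [T], as [<(T - step_op) u, u>] is the integral
   of [t - floor (p t) / p] for the measure of [u]; and its powers are explicit. *)
Definition step_op u : l2 R I := \sum_(k < n) (x k)%:C%C *: E (Ak k) u.

(** Projections of disjoint cells annihilate each other, so powers act on the coefficients only. The
    exponent starts at [1] because the zeroth power would require these projections to sum to the
    identity. *)
Let stepXE m u : iter m.+1 step_op u = \sum_(k < n) (x k ^+ m.+1)%:C%C *: E (Ak k) u.
Proof.
elim: m => [|m IH]; first by [].
rewrite iterS IH /step_op; apply: eq_bigr => k _.
have -> : E (Ak k) (\sum_(l < n) (x l ^+ m.+1)%:C%C *: E (Ak l) u) =
    \sum_(l < n) (x l ^+ m.+1)%:C%C *: E (Ak k) (E (Ak l) u).
  rewrite (big_morph _ (ED (mAk k)) (E0 (mAk k))).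
  by apply: eq_bigr => l _; rewrite EZ.
rewrite (bigD1 k)//= big1 ?addr0 => [|l lk].
  by rewrite Eid// scalerA -rmorphM -exprS.
rewrite -(spectral_setI TE)// (_ : _ `&` _ = set0) ?Eset0 ?scaler0//.
rewrite -subset0 => t; rewrite /Ak /= !in_itv/= => -[/andP[k1 k2] /andP[l1 l2]].
have := le_lt_trans k1 l2; have := le_lt_trans l1 k2.
rewrite /x !ltr_pM2r ?invr_gt0// !ltr_nat !ltnS => h1 h2.
by move/eqP: lk; apply; apply/val_inj/eqP; rewrite /= eqn_leq h1 h2.
Qed.

Let step_moment (mu : {finite_measure set (measurableTypeR R) -> \bar R}) u m :
  (forall A, measurable A -> rdot (E A u) u = fine (mu A)) ->
  rdot (iter m.+1 step_op u) u = \sum_(k < n) x k ^+ m.+1 * fine (mu (Ak k)).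
Proof.
move=> muE; rewrite stepXE rdot_suml; apply: eq_bigr => k _.
by rewrite rdotZl muE.
Qed.

Let diff_op u := T u - step_op u.

Let stepD : {morph step_op : u v / u + v}.
Proof.
move=> u v; rewrite /step_op -big_split/=; apply: eq_bigr => k _.
by rewrite ED// scalerDr.
Qed.

(** The spectral measure controls only the quadratic form of [diff_op]; symmetry upgrades this to a
    norm bound, which can be iterated. *)
Let diff_le u : sqnorm (diff_op u) <= p%:R^-1 ^+ 2 * sqnorm u.
Proof.
apply: sqnorm_quadratic_form; rewrite ?invr_gt0//.
- by move=> {}u v; rewrite /diff_op TD stepD opprD addrACA.
- move=> a {}u; rewrite /diff_op TZ scalerBr; congr (_ - _).
  rewrite /step_op scaler_sumr; apply: eq_bigr => k _.
  by rewrite EZ// !scalerA mulrC.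
- move=> {}u v; rewrite /diff_op rdotDl rdotDr rdotNl rdotNr; congr (_ - _).
    by rewrite /rdot Ts.
  rewrite [RHS]rdotC !rdot_suml; apply: eq_bigr => k _.
  by rewrite !rdotZl Es// [in RHS]rdotC.
move=> {}u; have [mu [muE mu0 muD muT]] := measureD u.
rewrite /diff_op rdotDl rdotNl muT -muD.
have -> : step_op u = iter 1 step_op u by [].
rewrite (step_moment _ muE).
under eq_bigr do rewrite expr1.
rewrite DE; apply: dist_Rintegral_step => //; last by move=> k t _; exact: xS.
rewrite -DE; apply: (@integrable_bounded _ mu D _ L) => // t.
rewrite /= in_itv/= => /andP[t0 tL]; rewrite ger0_norm// ltW//.
Qed.

Let L1 : 1 <= L. Proof. by rewrite ler1n. Qed.

Let T_le u : sqnorm (T u) <= L ^+ 2 * sqnorm u.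
Proof.
apply: sqnorm_quadratic_form => //; rewrite ?ltr0n//.
  by move=> {}u v; rewrite /rdot Ts.
move=> {}u; rewrite (le_trans (TK u))// ler_wpM2r ?sqnorm_ge0//.
by rewrite ler_nat.
Qed.

Let pinv1 : p%:R^-1 ^+ 2 <= 1 :> R.
Proof.
by rewrite -[leRHS](expr1n _ 2) lerXn2r ?nnegrE ?invr_ge0 ?ler0n// invf_le1// ler1n.
Qed.

Let step_le u : sqnorm (step_op u) <= 2 * (L ^+ 2 + 1) * sqnorm u.
Proof.
have -> : step_op u = T u + - diff_op u by rewrite /diff_op opprB addrC subrK.
rewrite (le_trans (sqnormD_le _ _))// -mulrA ler_pM2l// mulrDl lerD// mul1r.
have -> : sqnorm (- diff_op u) = sqnorm (diff_op u).
  by rewrite /sqnorm rdotNl rdotNr opprK.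
by rewrite (le_trans (diff_le u))// -[leRHS]mul1r ler_wpM2r ?sqnorm_ge0.
Qed.

Let iterT_le m u : sqnorm (iter m T u) <= (L ^+ 2) ^+ m * sqnorm u.
Proof.
elim: m => [|m IH]; first by rewrite mul1r.
by rewrite iterS (le_trans (T_le _))// [_ ^+ m.+1]exprS -mulrA ler_wpM2l// sqr_ge0.
Qed.

(** The constant produced by the recursion in [iter_diff_le]; all that matters is that it does not
    depend on [p]. *)
Fixpoint iter_cst (m : nat) : R :=
  if m is m'.+1 then 2 * ((L ^+ 2) ^+ m' + 2 * (L ^+ 2 + 1) * iter_cst m') else 0.

Let iter_diff_le m u :
  sqnorm (iter m T u - iter m step_op u) <= p%:R^-1 ^+ 2 * (iter_cst m * sqnorm u).
Proof.
elim: m => [|m IH]; first by rewrite /= subrr mul0r mulr0 /sqnorm rdot0l.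
set a := iter m T u in IH *; set b := iter m step_op u in IH *.
(* Telescoping, with [S] for [step_op]: [T^(m+1) - S^(m+1) = (T - S) T^m + S (T^m - S^m)]. *)
have -> : iter m.+1 T u - iter m.+1 step_op u = diff_op a + step_op (a - b).
  have sa : step_op a = step_op (a - b) + step_op b by rewrite -stepD subrK.
  by rewrite !iterS -/a -/b /diff_op sa opprD [- _ - _]addrC addrA subrK.
rewrite (le_trans (sqnormD_le _ _))//.
have H1 : sqnorm (diff_op a) <= p%:R^-1 ^+ 2 * ((L ^+ 2) ^+ m * sqnorm u).
  by rewrite (le_trans (diff_le _))// ler_wpM2l// ?sqr_ge0// iterT_le.
have H2 : sqnorm (step_op (a - b)) <=
    p%:R^-1 ^+ 2 * (2 * (L ^+ 2 + 1) * (iter_cst m * sqnorm u)).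
  rewrite (le_trans (step_le _))// [leRHS]mulrCA ler_wpM2l//.
move: H1; rewrite -subr_ge0 => H1; move: H2; rewrite -subr_ge0 => H2; rewrite /= -subr_ge0.
rewrite [leRHS](_ : _ =
  2 * (p%:R^-1 ^+ 2 * ((L ^+ 2) ^+ m * sqnorm u) - sqnorm (diff_op a)) +
  2 * (p%:R^-1 ^+ 2 * (2 * (L ^+ 2 + 1) * (iter_cst m * sqnorm u))
       - sqnorm (step_op (a - b)))); last by ring.
by rewrite addr_ge0 ?mulr_ge0.
Qed.

(** Both quantities are compared with the corresponding moment of [step_op]: the operator side by
    [iter_diff_le], the integral side by a Riemann sum. Both errors are of order [1 / p]. *)
Lemma dist_moment_step (mu : {finite_measure set (measurableTypeR R) -> \bar R}) u m :
  (forall A, measurable A -> rdot (E A u) u = fine (mu A)) ->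
  fine (mu D) = sqnorm u ->
  `|rdot (iter m.+1 T u) u - \int[mu]_(t in D) (t : R) ^+ m.+1| <=
    p%:R^-1 * (((iter_cst m.+1 + 1) / 2 + m.+1%:R * L ^+ m.+1) * sqnorm u).
Proof.
move=> muE muD.
have pn0 : p%:R != 0 :> R by rewrite gt_eqF.
set c := iter_cst m.+1.
have H1 : `|rdot (iter m.+1 T u - iter m.+1 step_op u) u| <=
    p%:R^-1 * ((c + 1) / 2 * sqnorm u).
  (* The square norm of the first vector is of order [p^-2]; the weight [p] makes both terms of
     order [1 / p]. *)
  apply: (le_trans (norm_rdot_le _ _ pR)).
  have := iter_diff_le m.+1 u; rewrite -/c; set y := sqnorm _ => Hy.
  rewrite [leRHS](_ : _ = (p%:R * (p%:R^-1 ^+ 2 * (c * sqnorm u))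
      + p%:R^-1 * sqnorm u) / 2); last by field.
  by rewrite ler_pM2r ?invr_gt0// lerD2r ler_pM2l.
have mpow : measurable_fun D (fun t : measurableTypeR R => (t : R) ^+ m.+1).
  exact: exprn_measurable.
have powL t : D t -> `|t ^+ m.+1| <= L ^+ m.+1.
  rewrite /= in_itv/= => /andP[t0 tL].
  by rewrite ger0_norm ?exprn_ge0// lerXn2r ?nnegrE// ltW.
have H2 : `|\int[mu]_(t in D) (t : R) ^+ m.+1 - rdot (iter m.+1 step_op u) u| <=
    p%:R^-1 * (m.+1%:R * L ^+ m.+1 * sqnorm u).
  rewrite (step_moment _ muE) -muD mulrA DE.
  apply: (@dist_Rintegral_step _ mu x (fun t => t ^+ m.+1) (fun k => x k ^+ m.+1)) => //.
    by rewrite -DE; exact: (@integrable_bounded _ mu D _ (L ^+ m.+1)).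
  (* The cofactor of [t - x k] has [m + 1] terms, each at most [L^m], hence at most [L^(m+1)]
     because [1 <= L]. *)
  move=> k t kn tk; rewrite subrXX normrM ler_pM// ?xS//.
  rewrite (le_trans (ler_norm_sum _ _ _))//.
  rewrite -[X in X%:R * _](card_ord m.+1) mulr_natl -sumr_const ler_sum// => i _.
  have xn : x n = L by rewrite /x /n natrM mulfK.
  have xk0 : 0 <= x k by rewrite /x divr_ge0.
  move: tk; rewrite in_itv/= => /andP[kt tk].
  have t0 : 0 <= t by rewrite (le_trans xk0).
  have tL : t <= L by rewrite -xn (le_trans (ltW tk))// xh.
  rewrite normrM !ger0_norm ?exprn_ge0//.
  apply: (@le_trans _ _ (L ^+ (m - i) * L ^+ i)).
    by rewrite ler_pM ?exprn_ge0// lerXn2r ?nnegrE// ?(le_trans kt tL)// (le_trans t0).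
  by rewrite -exprD subnK ?ler_weXn2l// -ltnS.
rewrite rdotDl rdotNl in H1.
move: H1 H2; set X := rdot _ u; set Y := rdot _ u; set Z := \int[mu]_(_ in _) _.
move=> H1 H2; rewrite mulrDl mulrDr (le_trans _ (lerD H1 H2))//.
by rewrite [X in _ <= _ + X]distrC -{1}(subrK Y X) -addrA ler_normD.
Qed.
End step.

(** The mesh [1 / p] tends to [0] in [dist_moment_step]; the zeroth moment is the total mass of
    [D]. *)
Lemma spectral_moment (mu : {finite_measure set (measurableTypeR R) -> \bar R}) u m :
  (forall A, measurable A -> rdot (E A u) u = fine (mu A)) ->
  \int[mu]_(t in D) (t : R) ^+ m = rdot (iter m T u) u.
Proof.
move=> muE; have muD := fine_measureD muE.
case: m => [|m].
  by under eq_Rintegral do rewrite expr0; rewrite Rintegral_cst// mul1r.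
apply/eqP; rewrite eq_sym -subr_eq0 -normr_le0; apply/ler_addgt0Pr => e e0; rewrite add0r.
set C := (((iter_cst m.+1 + 1) / 2 + m.+1%:R * L ^+ m.+1) * sqnorm u).
have H p := @dist_moment_step p.+1 isT mu u m muE muD.
rewrite -/C in H; apply: le_trans (H (Num.truncn (C / e))) _.
rewrite mulrC ler_pdivrMr ?ltr0n// mulrC -ler_pdivrMr//.
exact/ltW/truncnS_gt.
Qed.
End spectral_measure.

(** * The logarithm as a limit of polynomials *)

Section log_series.
Context {R : realType}.
Implicit Types a x : R.

Definition log_poly (M : nat) (a : R) : R := \sum_(j < M) (1 - a) ^+ j.+1 / j.+1%:R.

Lemma log_polyS M a : log_poly M.+1 a = log_poly M a + (1 - a) ^+ M.+1 / M.+1%:R.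
Proof. by rewrite /log_poly big_ord_recr. Qed.

Lemma is_derive_log_poly M x : is_derive x 1 (log_poly M) (- \sum_(j < M) (1 - x) ^+ j).
Proof.
elim: M => [|M IH].
  rewrite big_ord0 oppr0 (_ : log_poly 0 = cst 0); first exact: is_derive_cst.
  by apply/funext => a; rewrite /log_poly big_ord0.
rewrite big_ord_recr/= opprD.
have -> : log_poly M.+1 = log_poly M + (M.+1%:R^-1 \*: ((cst 1 - id) ^+ M.+1)).
  apply/funext => a; rewrite log_polyS /= mulrC; congr (_ + _).
  by rewrite /GRing.scale /= exprfctE.
apply: is_deriveD; apply: is_derive_eq.
rewrite sub0r scalerN scaler1 /GRing.scale/= mulrN mulrA mulVf ?mul1r//.
Qed.

(** Mean value theorem on [[a, 1]] for the remainder [g]: it vanishes at [1], and summing the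
    geometric series gives the derivative [- (1 - x)^M / x]. *)
Lemma log_poly_le M a : 0 < a -> a <= 1 ->
  0 <= - ln a - log_poly M a <= (1 - a) ^+ M / a.
Proof.
move=> a0; rewrite le_eqVlt => /predU1P[->|a1].
  rewrite ln1 subrr oppr0 sub0r /log_poly big1 ?oppr0 ?lexx ?divr1 ?exprn_ge0//.
  by move=> j _; rewrite subrr expr0n mul0r.
pose g := fun x => - ln x - log_poly M x.
have dg (x : R) : 0 < x -> is_derive x 1 g (- ((1 - x) ^+ M / x)).
  move=> x0; have := is_derive_log_poly M x => h1; have h2 := is_derive1_ln x0.
  have : is_derive x 1 (- (@ln R) - log_poly M) (- x^-1 - (- \sum_(j < M) (1 - x) ^+ j)).
    by apply: is_deriveB; apply: is_deriveN.
  congr is_derive.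
  have := subrX1 (1 - x) M; rewrite addrAC subrr sub0r mulNr => h.
  have xn0 := lt0r_neq0 x0.
  have -> : \sum_(j < M) (1 - x) ^+ j = (1 - (1 - x) ^+ M) / x.
    by apply: (mulfI xn0); rewrite mulrCA divff// mulr1 -[LHS]opprK -h opprB.
  by rewrite opprK; field.
have [b] : exists2 b, b \in `]a, 1[%R & g 1 - g a = - ((1 - b) ^+ M / b) * (1 - a).
  apply: (@MVT _ g (fun x => - ((1 - x) ^+ M / x))) => // [x|].
    by rewrite in_itv/= => /andP[ax _]; apply: dg; exact: lt_trans ax.
  apply: derivable_within_continuous => x; rewrite in_itv/= => /andP[ax _].
  by have [] := dg x (lt_le_trans a0 ax).
rewrite in_itv/= => /andP[ab b1] E.
have g1 : g 1 = 0.
  rewrite /g ln1 oppr0 sub0r /log_poly big1 ?oppr0// => j _.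
  by rewrite subrr expr0n mul0r.
have b0 : 0 < b by exact: lt_trans ab.
have -> : - ln a - log_poly M a = (1 - b) ^+ M / b * (1 - a).
  by rewrite -/(g a); move: E; rewrite g1 mulNr sub0r => /oppr_inj.
have u0 : 0 <= 1 - b by rewrite subr_ge0 ltW.
have v0 : 0 <= 1 - a by rewrite subr_ge0 ltW.
rewrite !mulr_ge0 ?exprn_ge0 ?invr_ge0 ?(ltW b0)//=.
apply: (@le_trans _ _ ((1 - b) ^+ M / b)).
  by rewrite ler_piMr ?mulr_ge0 ?exprn_ge0 ?invr_ge0 ?(ltW b0)// gerBl ltW.
rewrite ler_pM ?exprn_ge0 ?invr_ge0 ?(ltW b0)//.
  by rewrite lerXn2r ?nnegrE// lerB// ltW.
by rewrite lef_pV2 ?posrE// ltW.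
Qed.

Lemma log_poly_ge0 M a : 0 <= a -> a <= 1 -> 0 <= log_poly M a.
Proof.
move=> a0 a1; apply: sumr_ge0 => j _; rewrite divr_ge0// exprn_ge0//.
by rewrite subr_ge0.
Qed.

Lemma log_poly_nd a : 0 <= a -> a <= 1 -> {homo log_poly^~ a : i j / (i <= j)%N >-> i <= j}.
Proof.
move=> a0 a1; apply: homo_leq; [exact: lexx|by move=> ? ? ?; exact: le_trans|move=> M].
by rewrite log_polyS lerDl divr_ge0// exprn_ge0// subr_ge0.
Qed.

Lemma log_poly_le0 M a : 0 <= a -> a <= 1 -> log_poly M a <= log_poly M 0.
Proof.
move=> a0 a1; apply: ler_sum => j _; rewrite ler_pM2r ?invr_gt0//.
by rewrite lerXn2r ?nnegrE ?subr_ge0// lerB.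
Qed.

Lemma cvg_log_poly a : 0 < a -> a <= 1 -> log_poly^~ a @ \oo --> - ln a.
Proof.
move=> a0 a1.
have H : (fun M => (1 - a) ^+ M / a) @ \oo --> (0 : R).
  rewrite -[X in _ --> X](mul0r a^-1); apply: cvgMl.
  by apply: cvg_expr; rewrite ger0_norm ?subr_ge0// gtrBl.
have H2 : (fun M => - ln a - log_poly M a) @ \oo --> (0 : R).
  apply: (@squeeze_cvgr _ _ _ _ (cst 0)) H; last exact: cvg_cst.
  by near=> M; exact: log_poly_le.
have : (fun M => - ln a - (- ln a - log_poly M a)) @ \oo --> - ln a - 0.
  by apply: cvgB => //; exact: cvg_cst.
rewrite subr0; apply: cvg_trans; apply: near_eq_cvg; near=> M.
by rewrite opprB addrC subrK.
Unshelve. all: by end_near. Qed.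

Lemma measurable_log_poly M : measurable_fun setT (log_poly M).
Proof.
rewrite /log_poly; apply: measurable_sum => j.
apply: measurable_funM => //.
by apply: measurable_funX; apply: measurable_funB.
Qed.
End log_series.

(** * From polynomial inequalities to the integral of the logarithm *)

Section limit_measure.
Context {R : realType} (nu : {finite_measure set (measurableTypeR R) -> \bar R}).
Variables (L : R) (L1 : 1 <= L).
Local Notation D := (`[0, L[%classic : set (measurableTypeR R)).
Local Notation D0 := (`]0, L[%classic : set (measurableTypeR R)).
Local Notation a t := ((t / L) ^+ 2).
(** Since [- ln (a t) = c - 2 ln t], the goal [0 <= \int ln t] over [D0] is equivalent to
    [\int - ln (a t) <= c nu(D0)]. *)
Local Notation c := (ln (L ^+ 2)).

Let L0 : 0 < L. Proof. exact: lt_le_trans L1. Qed.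
Let mD : measurable D. Proof. exact: measurable_itv. Qed.
Let mD0 : measurable D0. Proof. exact: measurable_itv. Qed.
Let c0 : 0 <= c.
Proof. by rewrite ln_ge0// -[leLHS](expr1n _ 2) lerXn2r ?nnegrE// ltW. Qed.

Let a_ge0 (t : R) : 0 <= a t. Proof. exact: sqr_ge0. Qed.
Let a_le1 t : D t -> a t <= 1.
Proof.
rewrite /= in_itv/= => /andP[t0 /ltW tL].
by rewrite -[leRHS](expr1n _ 2) lerXn2r ?nnegrE ?divr_ge0 ?(ltW L0)// ler_pdivrMr ?mul1r.
Qed.

Let D0D t : D0 t -> D t.
Proof. by rewrite /= !in_itv/= => /andP[/ltW -> ->]. Qed.

Let ma : measurable_fun setT (fun t : measurableTypeR R => a (t : R)).
Proof. by apply: measurable_funX; apply: measurable_funM. Qed.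

Let mlog M : measurable_fun setT (fun t : measurableTypeR R => log_poly M (a (t : R))).
Proof. exact: (measurableT_comp (measurable_log_poly M)). Qed.

Let log_int M (B : set (measurableTypeR R)) : measurable B -> B `<=` D ->
  nu.-integrable B (EFin \o (fun t : measurableTypeR R => log_poly M (a (t : R)))).
Proof.
move=> mB BD; apply: (@integrable_bounded _ _ _ _ (log_poly M 0)) => //.
  exact: measurable_funS (mlog M).
move=> t /BD Dt; rewrite ger0_norm ?log_poly_ge0 ?log_poly_le0//; exact: a_le1.
Qed.

Let pow_cvg : (fun m => \int[nu]_(t in D) (1 - a (t : R)) ^+ m) @ \oo --> fine (nu [set 0]).
Proof.
have nuE : fine (nu [set 0]) = \int[nu]_(t in D) \1_([set 0] : set R) t.
  rewrite /Rintegral integral_indic// ?setIidl//.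
    by move=> t ->; rewrite /= in_itv/= lexx.
rewrite nuE; apply: fine_cvg; rewrite fineK; last first.
  apply: integrable_fin_num => //.
  by apply: (integrableS measurableT) => //; exact: integrable_indic.
apply: (@dominated_cvg _ (measurableTypeR R) R nu D mD
  (fun m (t : measurableTypeR R) => ((1 - a (t : R)) ^+ m)%:E)
  (fun t : measurableTypeR R => (\1_([set 0] : set R) t)%:E) (cst 1%E)).
- move=> m; apply/measurable_EFinP; apply: measurable_funX.
  by apply: measurable_funB => //; exact: measurable_funTS.
- move=> t Dt; apply: cvg_EFin; first exact: nearW.
  have [->|t0] := eqVneq t 0.
    rewrite indicE mem_set//= mul0r expr0n/= subr0.
    by under eq_fun do rewrite /= expr1n; exact: cvg_cst.
  rewrite indicE memNset/=; last by move/eqP; exact/negP.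
  apply: cvg_expr; rewrite ger0_norm ?subr_ge0 ?a_le1// gtrBl.
  by rewrite exprn_even_gt0//= mulf_neq0// invr_neq0// gt_eqF.
- by [].
- exact: finite_measure_integrable_cst.
- move=> m t Dt; rewrite /= lee_fin ger0_norm ?exprn_ge0 ?subr_ge0 ?a_le1//.
  by rewrite exprn_ile1 ?subr_ge0 ?a_le1// gerBl.
Qed.

(** The shape inherited from finite spectra; there, the condition on [M] makes the correction by
    [(1 - a)^m] nonnegative. *)
Hypothesis H : forall M m, c <= log_poly M 0 ->
  \int[nu]_(t in D) log_poly M (a (t : R)) <=
  c * fine (nu D) + (log_poly M 0 - c) * \int[nu]_(t in D) (1 - a (t : R)) ^+ m.

(** If [log_poly M 0 < c], the bound is pointwise. Otherwise [m] tends to infinity in [H], and the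
    atom at [0] contributes [log_poly M 0 * nu {0}] to both sides, so that it cancels. *)
Let log_poly_integral_le M :
  \int[nu]_(t in D0) log_poly M (a (t : R)) <= c * fine (nu D0).
Proof.
have [cM|/ltW Mc] := leP c (log_poly M 0); last first.
  rewrite -Rintegral_cst//; apply: le_Rintegral => //.
  - by apply: log_int => // t; exact: D0D.
  - exact: finite_measure_integrable_cst.
  - by move=> t /D0D Dt; rewrite (le_trans _ Mc)// log_poly_le0// a_le1.
have DE : D = [set 0] `|` D0.
  apply/seteqP; split => t; rewrite /= !in_itv/=.
    by move=> /andP[]; rewrite le_eqVlt => /predU1P[->|-> ->]; [left|right].
  by move=> [->|/andP[/ltW -> ->]//]; rewrite lexx.
have dj : [disjoint ([set 0] : set (measurableTypeR R)) & D0].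
  by apply/disj_setPS => t [/= ->]; rewrite in_itv/= ltxx.
have : \int[nu]_(t in D) log_poly M (a (t : R)) <=
    c * fine (nu D) + (log_poly M 0 - c) * fine (nu [set 0]).
  apply: (@cvgr_to_ge _ \oo _ _
    (fun m => c * fine (nu D)
      + (log_poly M 0 - c) * \int[nu]_(t in D) (1 - a (t : R)) ^+ m)).
    by apply: cvgD; [exact: cvg_cst | apply: cvgMr; exact: pow_cvg].
  by apply: nearW => m; exact: H.
rewrite DE fine_measureU// Rintegral_setU//; last by rewrite -DE; exact: log_int.
rewrite (_ : \int[nu]_(t in [set 0]) _ = log_poly M 0 * fine (nu [set 0])); last first.
  rewrite -Rintegral_cst//; apply: eq_Rintegral => t.
  by rewrite inE => ->; rewrite mul0r expr0n.
by rewrite mulrDr mulrBl; lra.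
Qed.

(** Monotone convergence in [M]. The integral is kept in [\bar R] because its finiteness is part of
    what is proved. *)
Let log_integral_le : (\int[nu]_(t in D0) (- ln (a (t : R)))%:E <= (c * fine (nu D0))%:E)%E.
Proof.
have aD0 t : D0 t -> 0 < a t.
  rewrite /= in_itv/= => /andP[t0 _].
  by rewrite exprn_gt0// divr_gt0.
have -> : (\int[nu]_(t in D0) (- ln (a (t : R)))%:E =
    \int[nu]_(t in D0) limn (fun M => (log_poly M (a (t : R)))%:E))%E.
  apply: eq_integral => t; rewrite inE => Dt; apply/esym/cvg_lim => //.
  by apply: cvg_EFin; [exact: nearW|apply: cvg_log_poly; [exact: aD0|exact/a_le1/D0D]].
rewrite (monotone_convergence _ mD0); last 3 first.
- move=> M; apply/measurable_EFinP; exact: measurable_funTS.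
- by move=> M t Dt; rewrite lee_fin log_poly_ge0// a_le1//; exact: D0D.
- by move=> t Dt i j ij; rewrite lee_fin log_poly_nd// a_le1//; exact: D0D.
apply: lime_le.
  apply: ereal_nondecreasing_is_cvgn => i j ij; apply: ge0_le_integral => //.
  - by move=> t Dt; rewrite lee_fin log_poly_ge0// a_le1//; exact: D0D.
  - by apply/measurable_EFinP; exact: measurable_funTS.
  - by apply/measurable_EFinP; exact: measurable_funTS.
  - by move=> t Dt; rewrite lee_fin log_poly_nd// a_le1//; exact: D0D.
apply: nearW => M.
have := log_poly_integral_le M; rewrite -lee_fin; apply: le_trans.
rewrite /Rintegral fineK//; apply: integrable_fin_num => //.
by apply: log_int => // t; exact: D0D.
Qed.

(** As [- ln a] is nonnegative on [D0], its upper bound also yields integrability; then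
    [ln t = (c + ln a) / 2] transfers both facts. *)
Lemma ln_integral_ge0 : nu.-integrable D0 (fun t : measurableTypeR R => (ln (t : R))%:E) /\
  (0 <= \int[nu]_(t in D0) (ln (t : R))%:E)%E.
Proof.
have lna t : D0 t -> - ln (a t) = c - 2 * ln t.
  rewrite /= in_itv/= => /andP[t0 _].
  by rewrite !lnXn ?divr_gt0// ln_div// mulrnBl opprB mulr_natl.
have mln : measurable_fun D0 (fun t : measurableTypeR R => ln (t : R)).
  by apply: measurable_funTS; exact: measurable_ln.
have lnai : nu.-integrable D0 (EFin \o (fun t : measurableTypeR R => - ln (a (t : R)))).
  apply/integrableP; split.
    apply/measurable_EFinP; apply: measurableT_comp => //.
    by apply: (measurableT_comp (@measurable_ln R)); exact: measurable_funTS.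
  apply: le_lt_trans (ltry (c * fine (nu D0))).
  apply: le_trans log_integral_le.
  rewrite le_eqVlt; apply/orP; left; apply/eqP; apply: eq_integral => t.
  rewrite inE => Dt /=; congr EFin; rewrite ger0_norm// oppr_ge0 ln_le0// a_le1//.
  exact: D0D.
have ci (r : R) : nu.-integrable D0 (EFin \o cst r) by exact: finite_measure_integrable_cst.
have lnE t : D0 t -> ln t = 2^-1 * (c - - ln (a t)) by move=> /lna ->; field.
have hi : nu.-integrable D0 (EFin \o (fun t : measurableTypeR R => c - - ln (a (t : R)))).
  by have := integrableB mD0 (ci c) lnai.
have lni : nu.-integrable D0 (fun t : measurableTypeR R => (ln (t : R))%:E).
  have := integrableZl mD0 2^-1 hi; apply: eq_integrable => // t.
  by rewrite inE => Dt /=; rewrite -EFinM -lnE.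
split => //.
rewrite -[leRHS]fineK ?integrable_fin_num// lee_fin.
rewrite -/(Rintegral nu D0 (fun t : measurableTypeR R => ln (t : R))).
rewrite (@eq_Rintegral _ _ _ nu D0
  (fun t : measurableTypeR R => 2^-1 * (c - - ln (a (t : R))))); last first.
  by move=> t; rewrite inE => Dt; exact: lnE.
rewrite RintegralZl// mulr_ge0// RintegralB//; last exact: ci.
rewrite Rintegral_cst// subr_ge0.
rewrite -lee_fin; apply: le_trans log_integral_le.
by rewrite /Rintegral fineK// integrable_fin_num.
Qed.
End limit_measure.

(** * Symmetric integer matrices *)

Lemma char_poly_conj (F : fieldType) N (P A : 'M[F]_N) : P \in unitmx ->
  char_poly (invmx P *m A *m P) = char_poly A.
Proof.
move=> Pu; rewrite /char_poly /char_poly_mx.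
have Pu' : map_mx (@polyC F) P *m map_mx (@polyC F) (invmx P) = 1%:M.
  by rewrite -map_mxM mulmxV// map_mx1.
have Pu2 : map_mx (@polyC F) (invmx P) *m map_mx (@polyC F) P = 1%:M.
  by rewrite -map_mxM mulVmx// map_mx1.
have -> : 'X%:M - map_mx (@polyC F) (invmx P *m A *m P) =
   map_mx (@polyC F) (invmx P) *m ('X%:M - map_mx (@polyC F) A) *m map_mx (@polyC F) P.
  rewrite mulmxBr mulmxBl !map_mxM; congr (_ - _).
  by rewrite mul_mx_scalar -scalemxAl Pu2 scalemx1.
by rewrite !det_mulmx mulrAC -det_mulmx Pu2 det1 mul1r.
Qed.

(** The lowest nonzero coefficient replaces the determinant, which would vanish for singular
    matrices. *)
Lemma coef_prod_XsubC (F : idomainType) N (l : 'I_N -> F) :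
  (\prod_(i < N) ('X - (l i)%:P))`_(#|[pred i | l i == 0]|) =
  \prod_(i < N | l i != 0) (- l i).
Proof.
rewrite (bigID (fun i => l i == 0))/=.
have -> : \prod_(i < N | l i == 0) ('X - (l i)%:P) = 'X^#|[pred i | l i == 0]|.
  rewrite -prodr_const; apply: eq_big => // i /eqP ->; by rewrite subr0.
rewrite coefXnM ltnn subnn -horner_coef0 horner_prod.
by apply: eq_bigr => i _; rewrite hornerXsubC sub0r.
Qed.

Section symmetric_int.
Variables (R : realType) (N : nat) (M : 'M[int]_N) (K : nat).
Hypothesis Msym : M^T = M.
Hypothesis MK : forall i, \sum_j `|M i j| <= K%:Z.

Let A : 'M[R[i]]_N := map_mx intr M.

(** Unitary diagonalization gives the trace formula, and a largest entry of an eigenvector bounds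
    its eigenvalue. For the product, the lowest nonzero coefficient of the characteristic polynomial
    is an integer, so its absolute value is at least [1]. *)
Lemma symmetric_int_spectrum : exists l : 'I_N -> R,
  [/\ forall m, (\tr (M ^+ m))%:~R = \sum_i l i ^+ m,
      forall i, `|l i| <= K%:R
    & 1 <= \prod_(i | l i != 0) `|l i| ].
Proof.
have Ah : A \is hermsymmx.
  apply: realsym_hermsym.
    apply/is_hermitianmxP; rewrite expr0 scale1r.
    rewrite map_mx_id//; apply/matrixP => i j; by rewrite !mxE -{1}Msym mxE.
  by apply/mxOverP => i j; rewrite mxE; apply/complex_realP; exists (M i j)%:~R; rewrite rmorph_int.
have Areal := hermitian_spectral_diag_real Ah.
have /orthomx_spectralP := hermitian_normalmx Ah.
set P := spectralmx A; set D := spectral_diag A => AE.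
have Pu : P \in unitmx by exact: spectral_unit.
have Dr i : {r : R | D 0 i = r%:C%C}.
  exists (complex.Re (D 0 i)); have /mxOverP/(_ 0 i) := Areal.
  by move=> /RRe_real.
pose l i := sval (Dr i).
have lE i : D 0 i = (l i)%:C%C by rewrite /l; case: (Dr i).
have CE (z : int) : ((z%:~R : R)%:C)%C = z%:~R :> R[i] by rewrite rmorph_int.
exists l; split.
- move=> m; apply: complexI; rewrite CE.
  have -> : ((\tr (M ^+ m))%:~R : R[i]) = \tr (A ^+ m).
    rewrite -[RHS]/(\tr (map_mx intr M ^+ m)).
    have -> : (map_mx intr M ^+ m : 'M[R[i]]_N) = map_mx intr (M ^+ m).
      elim: m => [|m IH]; first by rewrite !expr0 map_mx1.
      by rewrite !exprS IH [in RHS]map_mxM.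
    by rewrite -trace_map_mx.
  have -> : A ^+ m = invmx P *m (diag_mx D ^+ m) *m P.
    elim: m => [|m IH]; first by rewrite !expr0 mulmx1 mulVmx.
    rewrite !exprS IH {1}AE -!mulmxE !mulmxA; congr (_ *m _ *m _).
    by rewrite mulmxK.
  rewrite -mulmxA mxtrace_mulC mulmxK// rmorph_sum/=.
  have -> : diag_mx D ^+ m = diag_mx (\row_i D 0 i ^+ m).
    elim: m => [|m IH].
      apply/matrixP => i j; rewrite expr0 !mxE expr0; by case: (i == j).
    rewrite exprS IH -mulmxE mulmx_diag; congr diag_mx.
    by apply/rowP => i; rewrite !mxE exprS.
  rewrite mxtrace_diag; apply: eq_bigr => i _.
  by rewrite !mxE lE rmorphXn.
- move=> i; rewrite -lecR.
  have PA : P *m A = diag_mx D *m P by rewrite AE !mulmxA mulmxV// mul1mx.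
  have [j Pij] : exists j, P i j != 0.
    case: (pickP (fun j => P i j != 0)) => [j|H]; first by exists j.
    have r0 : row i P = 0.
      by apply/rowP => j; rewrite !mxE; have /= /negbFE/eqP := H j.
    have : row i (P *m invmx P) = 0 by rewrite row_mul r0 mul0mx.
    rewrite mulmxV// row1 => /rowP/(_ i); rewrite !mxE eqxx => /eqP.
    by rewrite eqxx oner_eq0.
  (* The order of [R[i]] is partial, so an entry of largest modulus is selected through its real
     value. Row [i] of [P] is a left eigenvector, and this entry bounds the eigenvalue by a column
     sum of [A], which is a row sum by symmetry. *)
  pose nP k : R := complex.Re `|P i k|.
  have nPE k : ((nP k)%:C)%C = `|P i k| by apply/RRe_real/normr_real.
  have [k kmax] : exists k, forall k0, `|P i k0| <= `|P i k|.
    have [k _ kmax] := @arg_maxP _ _ _ j xpredT nP isT.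
    by exists k => k0; rewrite -!nPE lecR; exact: kmax.
  have Pk : 0 < `|P i k| by apply: lt_le_trans (kmax j); rewrite normr_gt0.
  have E : D 0 i * P i k = \sum_k0 P i k0 * A k0 k.
    have := congr1 (fun X : 'M[R[i]]_N => X i k) PA.
    by rewrite mul_diag_mx !mxE => <-.
  have : `|D 0 i| * `|P i k| <= `|P i k| * K%:R.
    rewrite -normrM E (le_trans (ler_norm_sum _ _ _))//.
    apply: (@le_trans _ _ (`|P i k| * \sum_k0 `|A k0 k|)).
      rewrite mulr_sumr; apply: ler_sum => k0 _; rewrite normrM.
      by apply: ler_wpM2r; rewrite ?kmax.
    apply: ler_wpM2l => //.
    have -> : \sum_k0 `|A k0 k| = (\sum_k0 `|M k k0|)%:~R.
      rewrite rmorph_sum; apply: eq_bigr => k0 _.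
      by rewrite mxE -{1}Msym mxE -intr_norm.
    rewrite -[K%:R]/(K%:Z%:~R) ler_int; exact: MK.
  rewrite mulrC ler_pM2l// lE.
  by rewrite normc_def/= expr0n/= addr0 sqrtr_sqr rmorph_nat.
- have cE : map_poly intr (char_poly M) = \prod_(i < N) ('X - ((l i)%:C%C)%:P).
    rewrite map_char_poly -/A AE char_poly_conj// char_poly_trig ?diag_mx_is_trig//.
    by apply: eq_bigr => i _; rewrite !mxE eqxx mulr1n lE.
  have := coef_prod_XsubC (fun i => (l i)%:C%C).
  rewrite -cE coef_map/=; set z := (char_poly M)`_ _ => zE.
  have zE' : (z%:~R : R) = \prod_(i | l i != 0) (- l i).
    apply: complexI; rewrite CE zE rmorph_prod/=; apply: eq_big.
      by move=> i; rewrite -(inj_eq (@complexI R)).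
    by move=> i _; rewrite rmorphN.
  have z0 : z != 0.
    rewrite -(intr_eq0 R) zE'; apply/prodf_neq0 => i; by rewrite oppr_eq0.
  have -> : \prod_(i | l i != 0) `|l i| = `|z|%:~R.
    rewrite intr_norm zE' normr_prod; by apply: eq_bigr => i _; rewrite normrN.
  rewrite -[1]/(1%:~R) ler_int.
  by rewrite -gtz0_ge1 normr_gt0.
Qed.
End symmetric_int.

(** * Finite models of a group ring matrix *)

(** Acting on functions over an arbitrary finite type allows powers of the model to be compared with
    iterates of [int_act] without ordinal indices. *)
Definition finmx_act (I : finType) (m : I -> I -> int) (v : I -> int) : I -> int :=
  fun p => \sum_q m p q * v q.

Section finmx.
Variables (I : finType) (m : I -> I -> int).
Definition finmx : 'M[int]_#|{: I}| := \matrix_(a, b) m (enum_val a) (enum_val b).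

Lemma finmxXE l a b :
  (finmx ^+ l) a b =
  iter l (finmx_act m) (fun q => (q == enum_val b)%:R) (enum_val a).
Proof.
elim: l a => [|l IH] a; first by rewrite expr0 mxE/= (inj_eq enum_val_inj).
rewrite exprS mxE /= /finmx_act (reindex _ (onW_bij _ (enum_val_bij I)))/=.
by apply: eq_bigr => c _; rewrite mxE IH.
Qed.

Lemma mxtrace_finmxX l : \tr (finmx ^+ l) =
  \sum_p iter l (finmx_act m) (fun q => (q == p)%:R) p.
Proof.
rewrite (reindex _ (onW_bij _ (enum_val_bij I)))/=.
by apply: eq_bigr => c _; rewrite finmxXE.
Qed.

Lemma sum_finmx_norm a : \sum_b `|finmx a b| = \sum_q `|m (enum_val a) q|.
Proof.
rewrite [RHS](reindex _ (onW_bij _ (enum_val_bij I)))/=.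
by apply: eq_bigr => c _; rewrite mxE.
Qed.

Lemma norm_iter_finmx_act (K : nat) l p r : (forall q, \sum_q' `|m q q'| <= K%:Z) ->
  `|iter l (finmx_act m) (fun q => (q == p)%:R) r| <= K%:Z ^+ l.
Proof.
move=> mK; elim: l r => [|l IH] r /=; first by case: (r == p).
rewrite (le_trans (ler_norm_sum _ _ _))// exprS.
apply: (@le_trans _ _ (\sum_q `|m r q| * K%:Z ^+ l)).
  by apply: ler_sum => q _; rewrite normrM ler_wpM2l.
by rewrite -mulr_suml ler_wpM2r// exprn_ge0.
Qed.
End finmx.

Section group_ring.
Context {G : groupType} {d : nat}.
Variable A : 'M[zgroup_ring G]_d.

(** The formula of [mx_act_fun] over the integers: the comparison with the models is then an exact
    identity in [int]. *)
Definition int_act (u : 'I_d * G -> int) : 'I_d * G -> int := fun k =>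
  \sum_(j < d) \sum_(h <- finsupp (A k.1 j)) A k.1 j h * u (j, h^-1 * k.2)%g.

(** The trace of the [l]-th power of [A] in the group von Neumann algebra. *)
Definition moment (l : nat) : int :=
  \sum_(i < d) iter l int_act (fun k => (k == (i, 1%g))%:R) (i, 1%g).

(** One constant for both sides: it bounds the row sums of every model and the quadratic form of the
    operator. *)
Definition coef_norm : nat :=
  `|(\sum_i \sum_j \sum_(h <- finsupp (A i j)) `|A i j h|)%R|%N.

Section finite_model.
Variables (n : nat) (phi : G -> 'S_n).

(* The second Iverson bracket makes the model exactly symmetric when A is
   self-adjoint, although phi h^-1 need not be the inverse of phi h. *)
Definition model_coef (p q : 'I_d * 'I_n) : int :=
  \sum_(h <- finsupp (A p.1 q.1)) A p.1 q.1 h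
     * ((q.2 == phi h p.2) && (p.2 == phi h^-1%g q.2))%:R.

(** The substitution of [h^-1] for [h] exchanges the supports of the two entries and the two Iverson
    brackets. *)
Lemma model_coef_sym p q : (forall i j h, A i j h = A j i h^-1%g) ->
  model_coef p q = model_coef q p.
Proof.
move=> As; rewrite /model_coef.
have pm : perm_eq [seq (h^-1)%g | h <- finsupp (A p.1 q.1)] (finsupp (A q.1 p.1)).
  apply: uniq_perm; rewrite ?fset_uniq//.
    by rewrite map_inj_uniq ?fset_uniq//; exact: invg_inj.
  move=> h; apply/mapP/idP => [[g gA ->]|hA].
    by move: gA; rewrite !mem_finsupp (As p.1).
  by exists h^-1%g; rewrite ?invgK// mem_finsupp -As -mem_finsupp.
rewrite -(perm_big _ pm)/= big_map; apply: eq_bigr => h _.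
by rewrite -As invgK andbC.
Qed.

Lemma sum_model_coef_norm p : \sum_q `|model_coef p q| <= coef_norm%:Z.
Proof.
apply: (@le_trans _ _ (\sum_j \sum_(h <- finsupp (A p.1 j)) `|A p.1 j h|)).
  rewrite -(pair_bigA _ (fun j y => `|model_coef p (j, y)|))/=.
  apply: ler_sum => j _; rewrite /model_coef/=.
  apply: (@le_trans _ _ (\sum_y \sum_(h <- finsupp (A p.1 j))
     `|A p.1 j h| * (y == phi h p.2)%:R)).
    apply: ler_sum => y _; rewrite (le_trans (ler_norm_sum _ _ _))//.
    apply: ler_sum => h _; rewrite normrM ler_wpM2l//.
    by do 2 case: (_ == _).
  rewrite exchange_big/=; apply: ler_sum => h _; rewrite -mulr_sumr.
  rewrite (bigD1 (phi h p.2))//= eqxx big1 ?addr0 ?mulr1// => y /negPf->//.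
rewrite /coef_norm gez0_abs; last by do 3 apply: sumr_ge0 => ? _.
by rewrite [leRHS](bigD1 p.1)//= lerDl; apply: sumr_ge0 => i _; do 2 apply: sumr_ge0 => ? _.
Qed.

Definition coef_support : seq G :=
  flatten [seq flatten [seq (finsupp (A i j) : seq G) | j <- enum 'I_d] | i <- enum 'I_d].

Lemma mem_support i j h : h \in finsupp (A i j) -> h \in coef_support.
Proof.
move=> hA; apply/flattenP.
exists (flatten [seq (finsupp (A i j) : seq G) | j <- enum 'I_d]).
  by apply/mapP; exists i; rewrite ?mem_enum.
apply/flattenP; exists (enum_fset (finsupp (A i j))) => //.
by apply/mapP; exists j; rewrite ?mem_enum.
Qed.

(** [int_act] at [g] evaluates its argument at the points [h^-1 * g], so these are the elements
    reached from [1] in [k] applications. *)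
Fixpoint word_ball (k : nat) : seq G :=
  if k is k'.+1 then [seq (h^-1 * g)%g | h <- coef_support, g <- word_ball k'] else [:: 1%g].

(** Exactly what [local_model] multiplies or separates from [1]: the coefficients [h], their
    inverses, and the labels [g^-1] of the points visited. *)
Definition test_words (L : nat) : seq G :=
  coef_support ++ [seq h^-1%g | h <- coef_support] ++
  [seq g^-1%g | g <- flatten [seq word_ball k | k <- iota 0 L.+1]].

Lemma mem_test_set L k g : (k <= L)%N -> g \in word_ball k -> g^-1%g \in test_words L.
Proof.
move=> kL gk; rewrite !mem_cat; apply/orP; right; apply/orP; right.
apply/mapP; exists g => //; apply/flattenP; exists (word_ball k) => //.
by apply/mapP; exists k; rewrite ?mem_iota.
Qed.

(** Permutations compose from left to right, hence [e] acts before [f] in the product [e * f]. *)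
Definition good_point (F : seq G) (x : 'I_n) : bool :=
  all (fun e => all (fun f => phi f (phi e x) == phi (e * f)%g x) F
    && ((e != 1%g) ==> (phi e x != x))) F.

(* Around [x], the map [g |-> phi g^-1 x] identifies the balls of the
   Cayley graph with those of the model and intertwines the two operators. *)
Lemma local_model L x i l k g j : good_point (test_words L) x -> phi 1%g = 1%g ->
  (l + k <= L)%N -> g \in word_ball k ->
  iter l (finmx_act model_coef) (fun q => (q == (i, x))%:R) (j, phi g^-1%g x) =
  iter l int_act (fun k => (k == (i, 1%g))%:R) (j, g).
Proof.
move=> /allP/= gx phi1.
have goodM e f : e \in test_words L -> f \in test_words L ->
    phi f (phi e x) = phi (e * f)%g x.
  by move=> eF fF; have /andP[/allP/(_ _ fF)/eqP] := gx _ eF.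
elim: l k g j => [|l IH] k g j.
  rewrite add0n /= !xpair_eqE => kL gk; congr ((_ && _)%:R).
  (* The two delta functions agree because [phi g^-1] moves [x] unless [g = 1]. *)
  have [->|g1] := eqVneq g 1%g; first by rewrite invg1 phi1 perm1 eqxx.
  have /andP[_ /implyP] := gx _ (mem_test_set kL gk).
  by rewrite invg_eq1 => /(_ g1)/negPf.
move=> lkL gk; have kL : (k < L)%N by apply: leq_trans lkL; rewrite addSnnS leq_addl.
rewrite !iterS {1}/finmx_act /int_act/=.
set W := iter l _ _ in IH *; set Z := iter l _ _ in IH *.
pose F j' y := model_coef (j, phi g^-1%g x) (j', y) * W (j', y).
rewrite (eq_bigr (fun q => F q.1 q.2)); last by case.
rewrite -(pair_bigA _ F)/= /F.
apply: eq_bigr => j' _; rewrite /model_coef/=.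
under eq_bigr do rewrite mulr_suml.
rewrite exchange_big/= big_seq [RHS]big_seq; apply: eq_bigr => h hA.
have hS := mem_support hA.
have hgk : (h^-1 * g)%g \in word_ball k.+1 by apply/allpairsP; exists (h, g).
have hF : h \in test_words L by rewrite mem_cat hS.
have hVF : h^-1%g \in test_words L.
  rewrite !mem_cat; apply/orP; right; apply/orP; left.
  by apply/mapP; exists h.
(* [phi h] sends the point of [g] to that of [h^-1 * g], and [E2] says that [phi h^-1] sends it
   back: both brackets of [model_coef] hold there. *)
have E1 : phi h (phi g^-1%g x) = phi (h^-1 * g)^-1%g x.
  by rewrite goodM//; [rewrite invMg invgK | exact: mem_test_set (ltnW kL) gk].
have E2 : phi h^-1%g (phi (h^-1 * g)^-1%g x) = phi g^-1%g x.
  by rewrite goodM//; [rewrite invMg invgK mulgK | exact: mem_test_set kL hgk].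
rewrite (bigD1 (phi h (phi g^-1%g x)))//= big1 ?addr0.
  by rewrite eqxx E1 E2 eqxx mulr1 (IH k.+1)// addnS -addSn.
by move=> y /negPf->; rewrite mulr0 mul0r.
Qed.

Lemma trace_good L x l : good_point (test_words L) x -> phi 1%g = 1%g -> (l <= L)%N ->
  \sum_i iter l (finmx_act model_coef) (fun q => (q == (i, x))%:R) (i, x) = moment l.
Proof.
move=> gx phi1 lL; apply: eq_bigr => i _.
rewrite -(@local_model L x i l 0 1%g i) ?addn0 ?mem_head//.
by rewrite invg1 phi1 perm1.
Qed.

(** A union bound: each pair [(e, f)] and each nontrivial [e] spoils at most [eps * n] points. *)
Lemma card_not_good (R : realType) (F : seq G) (eps : R) : 
  (forall e f : G, e \in F -> f \in F ->
     (1 - eps) * n%:R <= (nfix (phi e * phi f * (phi (e * f))^-1)%g)%:R) ->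
  (forall e : G, e \in F -> e != 1%g -> (nfix (phi e))%:R <= eps * n%:R) ->
  0 <= eps ->
  #|[pred x | ~~ good_point F x]|%:R <= (size F * (size F).+1)%:R * eps * n%:R.
Proof.
move=> FM F1 eps0.
pose B1 e f := [pred x | phi f (phi e x) != phi (e * f)%g x].
pose B2 e := [pred x | (e != 1%g) && (phi e x == x)].
have le1 x : (~~ good_point F x <= \sum_(e <- F) (\sum_(f <- F) B1 e f x + B2 e x))%N.
  case: (boolP (good_point F x)) => //= /allPn[e eF].
  rewrite negb_and negb_imply negbK => H.
  rewrite (perm_big _ (perm_to_rem eF)) big_cons.
  rewrite (leq_trans _ (leq_addr _ _))//.
  case/orP: H => [/allPn[f fF H]|->]; last by rewrite addn1.
  rewrite (perm_big _ (perm_to_rem fF)) big_cons.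
  by rewrite H.
have cardS (P : pred 'I_n) : (#|[pred x | P x]| = \sum_x P x)%N.
  rewrite -sum1_card big_mkcond; apply: eq_bigr => x _.
  by rewrite inE; case: (P x).
rewrite (cardS (fun x => ~~ good_point F x)).
apply: (@le_trans _ _ (\sum_(e <- F) (\sum_(f <- F) #|B1 e f| + #|B2 e|))%N%:R).
  rewrite ler_nat; apply: leq_trans; first by apply: leq_sum => x _; exact: le1.
  rewrite exchange_big/=; apply: leq_sum => e _.
  rewrite big_split/= leq_add//; last by rewrite (cardS (fun x => B2 e x)).
  rewrite exchange_big/=; apply: leq_sum => f _.
  by rewrite (cardS (fun x => B1 e f x)).
have B1le e f : e \in F -> f \in F -> #|B1 e f|%:R <= eps * n%:R.
  move=> eF fF; have := FM _ _ eF fF; rewrite mulrBl mul1r lerBlDr addrC -lerBlDr.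
  apply: le_trans; rewrite lerBrDr -natrD -[X in _ <= X%:R]card_ord ler_nat.
  rewrite /nfix -[leqRHS](cardC [pred i | (phi e * phi f * (phi (e * f))^-1)%g i == i]).
  rewrite addnC leq_add2l subset_leq_card//; apply/fintype.subsetP => x.
  rewrite !inE; apply: contra => /eqP H.
  rewrite !permM in H; have := congr1 (phi (e * f)%g) H.
  by rewrite permKV => ->.
have B2le e : e \in F -> #|B2 e|%:R <= eps * n%:R.
  move=> eF; have [e1|e1] := eqVneq e 1%g.
    rewrite (_ : #|B2 e| = 0)%N ?mulr_ge0//.
    by apply: eq_card0 => x; rewrite !inE e1 eqxx.
  apply: le_trans (F1 _ eF e1); rewrite ler_nat subset_leq_card//.
  by apply/fintype.subsetP => x; rewrite !inE => /andP[].
have sumF (c : R) : \sum_(e <- F) c = (size F)%:R * c.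
  by rewrite big_const_seq count_predT iter_addr_0 mulr_natl.
rewrite natr_sum; apply: (@le_trans _ _ (\sum_(e <- F) (size F).+1%:R * (eps * n%:R))).
  rewrite big_seq [leRHS]big_seq; apply: ler_sum => e eF.
  rewrite natrD -addn1 natrD mulrDl mul1r lerD ?B2le//.
  rewrite natr_sum -sumF big_seq [leRHS]big_seq.
  by apply: ler_sum => f fF; exact: B1le.
by rewrite sumF natrM !mulrA.
Qed.

Definition model : 'M[int]_#|{: 'I_d * 'I_n}| := finmx model_coef.

Lemma model_sym : (forall i j h, A i j h = A j i h^-1%g) -> model^T = model.
Proof.
move=> As; apply/matrixP => a b; rewrite !mxE; exact: model_coef_sym.
Qed.

Lemma sum_model_norm a : \sum_b `|model a b| <= coef_norm%:Z.
Proof. by rewrite sum_finmx_norm; exact: sum_model_coef_norm. Qed.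

(** A good point contributes exactly [moment l] to the trace; a bad one is estimated trivially, the
    entries of the [l]-th power being at most [coef_norm ^ l]. *)
Lemma dist_trace_model (R : realType) L (l : nat) : phi 1%g = 1%g -> (l <= L)%N ->
  `|(\tr (model ^+ l))%:~R - n%:R * (moment l)%:~R| <=
  #|[pred x | ~~ good_point (test_words L) x]|%:R *
     (d%:R * coef_norm%:R ^+ l + `|moment l|%:~R) :> R.
Proof.
move=> phi1 lL.
rewrite mxtrace_finmxX.
pose F i x := iter l (finmx_act model_coef) (fun q => (q == (i, x))%:R) (i, x).
rewrite (eq_bigr (fun q => F q.1 q.2)); last by case.
rewrite -(pair_bigA _ F)/= exchange_big/=.
have -> : n%:R * (moment l)%:~R = (\sum_(x < n) moment l)%:~R :> R.
  by rewrite sumr_const card_ord rmorphMn/= mulr_natl.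
rewrite -rmorphB/= -sumrB -intr_norm.
set C := #|_|; rewrite [leRHS](_ : _ =
  (C%:Z * (d%:Z * coef_norm%:Z ^+ l + `|moment l|))%:~R).
  rewrite ler_int (le_trans (ler_norm_sum _ _ _))//.
  rewrite (bigID (good_point (test_words L)))/= big1 ?add0r; last first.
    by move=> x gx; rewrite (@trace_good L)// subrr normr0.
  rewrite -[C%:Z]natz /C -sum1_card natr_sum mulr_suml ler_sum// => x _.
  rewrite mul1r (le_trans (ler_normB _ _))// lerD2r.
  rewrite (le_trans (ler_norm_sum _ _ _))//.
  apply: (@le_trans _ _ (\sum_(i < d) coef_norm%:Z ^+ l)).
    by apply: ler_sum => i _; apply: norm_iter_finmx_act; exact: sum_model_coef_norm.
  by rewrite sumr_const card_ord -[d%:Z]natz mulr_natl.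
by rewrite !(rmorphM, rmorphD, rmorphXn)/=.
Qed.
End finite_model.

(** Traces are divided by [n] and not by the size [d * n], in accordance with [moment 0 = d]. *)
Lemma sofic_approximation (R : realType) (L : nat) (eps : R) : sofic R G ->
  (forall i j h, A i j h = A j i h^-1%g) -> 0 < eps ->
  exists (n : nat) (N : nat) (M : 'M[int]_N),
   [/\ (0 < n)%N, N = (d * n)%N, M^T = M,
     forall a, \sum_b `|M a b| <= coef_norm%:Z &
     forall l, (l <= L)%N -> `|(\tr (M ^+ l))%:~R / n%:R - (moment l)%:~R| <= eps].
Proof.
move=> Gs As eps0.
pose c l : R := d%:R * coef_norm%:R ^+ l + `|moment l|%:~R.
have c0 l : 0 <= c l.
  by rewrite addr_ge0// ?mulr_ge0 ?exprn_ge0// ler0z.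
pose C := 1 + \sum_(l < L.+1) c l.
have C1 : 1 <= C by rewrite lerDl sumr_ge0.
pose F := test_words L; pose s : R := (size F * (size F).+1)%:R + 1.
have s1 : 1 <= s by rewrite lerDr.
have sC0 : 0 < s * C by rewrite mulr_gt0 ?(lt_le_trans ltr01).
(* At most [s * e * n] points are bad and each costs at most [C], so the normalized error is at most
   [s * e * C <= eps]; [1 / 2] ensures [e < 1]. *)
pose e := Num.min (1 / 2) (eps / (s * C)).
have e0 : 0 < e by rewrite lt_min !divr_gt0.
have e1 : e < 1 by rewrite gt_min; apply/orP; left; lra.
have [n n1 [phi [phiM phi1 phifix]]] := Gs e [fset x in F]%fset e0 e1.
have nR : 0 < n%:R :> R by rewrite ltr0n.
exists n, _, (model phi); split => //.
- by rewrite card_prod !card_ord.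
- exact: model_sym.
- exact: sum_model_norm.
move=> l lL.
rewrite -(ler_pM2r nR) -[X in _ * X <= _](ger0_norm (ltW nR)) -normrM.
rewrite mulrBl divfK ?gt_eqF//.
rewrite [X in _ - X]mulrC (le_trans (dist_trace_model _ phi1 lL))//.
have := @card_not_good _ phi R F e.
move=> /(_ _ _ (ltW e0)) H.
have {}H : #|[pred x | ~~ good_point phi F x]|%:R <= s * e * n%:R.
  apply: (le_trans (H _ _)).
  - by move=> a b aF bF; apply: phiM; rewrite in_fset.
  - by move=> a aF; apply: phifix; rewrite in_fset.
  - by rewrite ler_wpM2r ?ler_wpM2r ?lerDl// ltW.
apply: (le_trans (ler_wpM2r (c0 l) H)).
apply: (@le_trans _ _ (s * e * n%:R * C)).
  apply: ler_wpM2l; first by rewrite !mulr_ge0// ?ltW// (lt_le_trans ltr01).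
  rewrite /C (bigD1 (Ordinal (lL : (l < L.+1)%N)))//= addrCA lerDl addr_ge0// sumr_ge0//.
rewrite mulrAC ler_pM2r// -mulrA [e * C]mulrC mulrA mulrC -ler_pdivlMr//.
by rewrite ge_min lexx orbT.
Qed.
End group_ring.

(** * The logarithmic inequality on a finite spectrum *)

Section finite_spectrum.
Context {R : realType}.

Lemma sum_log_poly_le N (l : 'I_N -> R) (L : R) M m :
  0 < L -> (forall i, `|l i| <= L) -> 1 <= \prod_(i | l i != 0) `|l i| ->
  ln (L ^+ 2) <= log_poly M 0 ->
  \sum_i log_poly M ((l i / L) ^+ 2) <=
  \sum_i (ln (L ^+ 2) + (log_poly M 0 - ln (L ^+ 2)) * (1 - (l i / L) ^+ 2) ^+ m).
Proof.
move=> L0 lL pl1; set c := ln _ => cM.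
have a1 i : (l i / L) ^+ 2 <= 1.
  rewrite -(real_normK (num_real (l i / L))) normrM normfV (gtr0_norm L0) -[leRHS](expr1n _ 2).
  by rewrite lerXn2r ?nnegrE ?divr_ge0// ?(ltW L0)// ler_pdivrMr ?mul1r.
have r0 i : 0 <= (log_poly M 0 - c) * (1 - (l i / L) ^+ 2) ^+ m.
  by rewrite mulr_ge0 ?exprn_ge0 ?subr_ge0.
have ln_sum : 0 <= \sum_(i | l i != 0) ln `|l i|.
  suff -> : \sum_(i | l i != 0) ln `|l i| = ln (\prod_(i | l i != 0) `|l i|).
    exact: ln_ge0.
  have : 0 < \prod_(i | l i != 0) `|l i| /\
      \sum_(i | l i != 0) ln `|l i| = ln (\prod_(i | l i != 0) `|l i|).
    apply: (big_rec2 (fun x y => 0 < y /\ x = ln y)); first by rewrite ln1.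
    by move=> i x y i0 [y0 ->]; rewrite mulr_gt0 ?normr_gt0// lnM ?posrE ?normr_gt0.
  by case.
apply: (@le_trans _ _ (\sum_i (c + (log_poly M 0 - c) * (1 - (l i / L) ^+ 2) ^+ m)
   - 2 * \sum_(i | l i != 0) ln `|l i|)); last by rewrite gerBl mulr_ge0.
rewrite mulr_sumr [X in _ - X]big_mkcond -sumrB; apply: ler_sum => i _.
case: ifPn => [li0|/negPn/eqP ->]; last first.
  by rewrite mul0r expr0n/= !subr0 expr1n mulr1 addrC subrK.
have a0 : 0 < (l i / L) ^+ 2.
  by rewrite exprn_even_gt0//= mulf_neq0// invr_neq0// gt_eqF.
have /andP[+ _] := log_poly_le M a0 (a1 i); rewrite subr_ge0 => /le_trans; apply.
have li : 0 < `|l i| by rewrite normr_gt0.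
have -> : ln ((l i / L) ^+ 2) = 2 * ln `|l i| - c.
  rewrite -(real_normK (num_real (l i / L))) normrM normfV (gtr0_norm L0).
  by rewrite /c !lnXn ?divr_gt0// ln_div// mulrnBl mulr_natl.
by have := r0 i; lra.
Qed.
End finite_spectrum.

(** * Finite sums of finite measures, for the trace over the [d] diagonal entries *)

Section sum_measure.
Context {d : measure_display} {T : measurableType d} {R : realType} {n : nat}.
Variable mu : 'I_n -> {finite_measure set T -> \bar R}.

(** [msum] expects a sequence indexed by [nat], hence the padding by the zero measure. *)
Let mu_seq (k : nat) : {measure set T -> \bar R} :=
  if insub k is Some i then mu i : {measure set T -> \bar R} else mzero.

Definition sum_measure : set T -> \bar R := msum mu_seq n.

HB.instance Definition _ := Measure.on sum_measure.

Lemma sum_measureE A : sum_measure A = (\sum_(i < n) mu i A)%E.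
Proof. by rewrite /sum_measure /msum; apply: eq_bigr => i _; rewrite /mu_seq valK. Qed.

Let sum_measure_fin : fin_num_fun sum_measure.
Proof.
move=> A mA; rewrite sum_measureE; apply/sum_fin_numP => i _ _.
exact: fin_num_measure.
Qed.

HB.instance Definition _ := Measure_isFinite.Build _ _ _ sum_measure sum_measure_fin.

Lemma ge0_integral_sum_measure (D : set T) (f : T -> \bar R) : measurable D ->
  (forall x, D x -> (0 <= f x)%E) -> measurable_fun D f ->
  (\int[sum_measure]_(x in D) f x = \sum_(i < n) \int[mu i]_(x in D) f x)%E.
Proof.
move=> mD f0 mf; rewrite /sum_measure ge0_integral_measure_sum//.
by apply: eq_bigr => i _; rewrite /mu_seq valK.
Qed.
End sum_measure.

(** * The group ring matrix as an operator *)

Section group_ring_operator.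
Context {R : realType} {G : groupType} {d : nat}.
Variable A : 'M[zgroup_ring G]_d.
Local Notation H := (l2 R ('I_d * G)%type).
Local Notation T := (mx_act (R := R) A).

Lemma iter_mx_act_basis l k p :
  iter l T (basis_vector k) p = (iter l (int_act A) (fun q => (q == k)%:R) p)%:~R.
Proof.
elim: l p => [|l IH] p /=; first by case: (p == k).
rewrite /mx_act_fun /int_act rmorph_sum; apply: eq_bigr => j _.
rewrite rmorph_sum; apply: eq_bigr => h _.
by rewrite IH [in RHS]rmorphM.
Qed.

Lemma int_act_basis i j g g' :
  int_act A (fun q => (q == (j, g))%:R) (i, g') = A i j (g' * g^-1)%g.
Proof.
rewrite /int_act/= (bigD1 j)//= [X in _ + X]big1 ?addr0; last first.
  by move=> j' /negPf j'j; rewrite big1// => h _; rewrite xpair_eqE j'j mulr0.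
have E h : (h^-1 * g' == g)%g = (h == g' * g^-1)%g.
  by rewrite (can2_eq (mulKVg _) (mulKg _)) eq_sym -(can2_eq (mulgK _) (mulgKV _)) eq_sym.
under eq_bigr do rewrite xpair_eqE eqxx/= E.
have [gA|gA] := boolP ((g' * g^-1)%g \in finsupp (A i j)).
  rewrite (big_fsetD1 _ gA)/= eqxx mulr1 big_seq big1 ?addr0// => h.
  by rewrite !inE => /andP[/negPf -> _]; rewrite mulr0.
rewrite (fsfun_dflt gA) big_seq big1// => h hA.
by have [hE|] := eqVneq h _; rewrite ?mulr0//; move: gA; rewrite -hE hA.
Qed.

(** Testing on basis vectors isolates single coefficients; no conjugation appears because they are
    integers. *)
Lemma selfadjoint_coef : selfadjoint T -> forall i j h, A i j h = A j i h^-1%g.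
Proof.
move=> As i j h; apply/eqP; rewrite -(eqr_int R); apply/eqP.
have := As (basis_vector (j, 1%g)) (basis_vector (i, h)) => /(congr1 (@complex.Re R)).
rewrite -!/(rdot _ _) [RHS]rdotC !rdot_basis.
have := iter_mx_act_basis 1 (j, 1%g) (i, h) => /= ->.
have := iter_mx_act_basis 1 (i, h) (j, 1%g) => /= ->.
by rewrite !int_act_basis invg1 mulg1 mul1g -!(rmorph_int (real_complex R)).
Qed.


Definition shift_op (i j : 'I_d) (h : G) (u : H) : H := L2 (shift_fun_summable i j h u).

Lemma sqnorm_shift_op i j h u : sqnorm (shift_op i j h u) <= sqnorm u.
Proof.
rewrite !sqnorm_esum fine_le ?esum_sqnormc_fin//.
pose B : set ('I_d * G) := [set k | k.1 = i].
pose e (k : 'I_d * G) := (j, h^-1 * k.2)%g.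
have einj : set_inj B e.
  by move=> [k g] [k' g']; rewrite !inE /B/= => -> -> [] /mulgI ->.
apply: (@le_trans _ _ (\esum_(k in B) (sqnormc (u (e k)))%:E)%E).
  rewrite [leRHS]esum_mkcond; apply: le_esum => k _ /=.
  rewrite /shift_fun; case: ifPn => [/eqP ki|ki]; first by rewrite mem_set.
  by rewrite memNset ?/sqnormc/= ?expr0n ?addr0// => /= /eqP; rewrite (negPf ki).
rewrite -(esum_image B e (fun k => (sqnormc (u k))%:E))// esum_mkcond.
by apply: le_esum => k _; case: ifP => //; rewrite lee_fin sqnormc_ge0.
Qed.

Lemma mx_act_shift u : T u =
  \sum_i \sum_j \sum_(h <- finsupp (A i j)) ((A i j h)%:~R : R)%:C%C *: shift_op i j h u.
Proof.
have sumE (J : Type) (r : seq J) (F : J -> H) k :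
    (\sum_(j <- r) F j) k = \sum_(j <- r) F j k :> R[i].
  by rewrite -[LHS]/((\val (\sum_(j <- r) F j)) k) (raddf_sum \val) fct_sumE.
apply/val_inj/funext => k; rewrite [RHS]sumE (bigD1 k.1)//= [X in _ + X]big1 ?addr0.
  rewrite sumE; apply: eq_bigr => j _; rewrite sumE; apply: eq_bigr => h _.
  rewrite -[RHS]/(((A k.1 j h)%:~R : R)%:C%C * shift_fun k.1 j h u k).
  by rewrite /shift_fun eqxx rmorph_int.
move=> i ik; rewrite sumE big1// => j _; rewrite sumE big1// => h _.
rewrite -[LHS]/(((A i j h)%:~R : R)%:C%C * shift_fun i j h u k).
by rewrite /shift_fun eq_sym (negPf ik) mulr0.
Qed.

(** Triangle inequality over the shifts, each of which does not increase the norm. *)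
Lemma norm_rdot_mx_act u : `|rdot (T u) u| <= (coef_norm A)%:R * sqnorm u.
Proof.
have -> : (coef_norm A)%:R =
    \sum_i \sum_j \sum_(h <- finsupp (A i j)) `|(A i j h)%:~R| :> R.
  rewrite [LHS]pmulrn /coef_norm gez0_abs; last by do 3 apply: sumr_ge0 => ? _.
  do 3 (rewrite rmorph_sum; apply: eq_bigr => ? _).
  by rewrite -intr_norm.
rewrite mx_act_shift; do 3 (rewrite rdot_suml mulr_suml
  (le_trans (ler_norm_sum _ _ _))//; apply: ler_sum => ? _).
rewrite rdotZl normrM ler_wpM2l// (le_trans (norm_rdot_le _ _ ltr01))//.
by rewrite invr1 !mul1r; rewrite ler_pdivrMr// mulr_natr mulr2n lerD2r sqnorm_shift_op.
Qed.
End group_ring_operator.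

(** * The measure attached to the spectral density *)

Section stieltjes.
Context {R : realType} (nu : {finite_measure set (measurableTypeR R) -> \bar R}).
Variable f : cumulative R R.
Hypothesis fE : forall x, f x = fine (nu `[0, x]%classic).

Let P0 : set (measurableTypeR R) := `[0, +oo[%classic.
Let mP0 : measurable P0. Proof. exact: measurable_itv. Qed.

(** The Stieltjes measure and the restriction of [nu] to [[0, +oo[] agree on all intervals []a, b]],
    hence everywhere by uniqueness. For negative endpoints this holds because [[0, x]] is then
    empty. *)
Lemma lebesgue_stieltjes_mrestr (A : set (measurableTypeR R)) : measurable A ->
  A `<=` `]0, +oo[%classic -> lebesgue_stieltjes_measure f A = nu A.
Proof.
move=> mA AP.
rewrite (@lebesgue_stieltjes_measure_unique R f (mrestr nu mP0))//.
  rewrite /mrestr; congr (nu _); apply/setIidl => t /AP.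
  by rewrite /P0 /= !in_itv/= !andbT => /ltW.
move=> X /ocitvP[->|[[a b]/= ab ->]]; first by rewrite !measure0.
rewrite /lebesgue_stieltjes_measure /measure_extension/=.
rewrite measurable_mu_extE/=; last exact: is_ocitv.
rewrite wlength_itv_bnd ?ltW// !fE.
pose B : set (measurableTypeR R) := `]a, b]%classic `&` P0.
have mB : measurable B by apply: measurableI => //; exact: measurable_itv.
have -> : `[0, b]%classic = `[0, a]%classic `|` B :> set (measurableTypeR R).
  apply/seteqP; split => t; rewrite /B /P0 /= !in_itv/= ?andbT.
    by move=> /andP[t0 tb]; rewrite t0 tb andbT /=; case: leP => _; [left|right].
  by move=> [/andP[-> ta]|[/andP[_ ->] ->]//]; rewrite (le_trans ta)// ltW.
rewrite fine_measureU//; last first.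
  apply/disj_setPS => t []; rewrite /B /P0 /= !in_itv/= => /andP[_ ta] [/andP[]].
  by rewrite ltNge ta.
by rewrite addrC addKr fineK// fin_num_measure.
Qed.

Lemma stieltjes_integrable (h : measurableTypeR R -> \bar R) :
  nu.-integrable `]0, +oo[ h -> (lebesgue_stieltjes_measure f).-integrable `]0, +oo[ h.
Proof.
move=> /integrableP[mh hoo]; apply/integrableP; split => //.
rewrite (eq_measure_integral nu)//.
by move=> A mA AP; exact: lebesgue_stieltjes_mrestr.
Qed.

Lemma stieltjes_integral (h : measurableTypeR R -> \bar R) :
  (\int[lebesgue_stieltjes_measure f]_(t in `]0%R, +oo[) h t =
   \int[nu]_(t in `]0%R, +oo[) h t)%E.
Proof.
by apply: eq_measure_integral => A mA AP; exact: lebesgue_stieltjes_mrestr.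
Qed.
End stieltjes.

Section ln_det.
Context {R : realType} {G : groupType} {d : nat}.
Local Notation H := (l2 R ('I_d * G)%type).

(** The mass beyond [L] is null, so integrability on []0, L[] extends to []0, +oo[] and rules out
    the default value [-oo]. *)
Lemma ln_det_ge0 (T : H -> H)
    (nu : {finite_measure set (measurableTypeR R) -> \bar R}) (L : R) :
  1 <= L ->
  (forall x, spectral_density T x = fine (nu `[0, x]%classic)) ->
  nu (~` `[0, L[%classic) = 0%E ->
  (forall M m, ln (L ^+ 2) <= log_poly M 0 ->
    \int[nu]_(t in `[0, L[) log_poly M (((t : R) / L) ^+ 2) <=
    ln (L ^+ 2) * fine (nu `[0, L[%classic) +
    (log_poly M 0 - ln (L ^+ 2)) * \int[nu]_(t in `[0, L[) (1 - ((t : R) / L) ^+ 2) ^+ m) ->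
  (0 <= ln_det T)%E.
Proof.
move=> L1 fE nuL logH.
have [lni ln0] := ln_integral_ge0 L1 logH.
pose N : set (measurableTypeR R) := `[L, +oo[%classic.
have mN : measurable N by exact: measurable_itv.
have N0 : nu N = 0%E.
  apply: subset_measure0 nuL => //; first by apply: measurableC; exact: measurable_itv.
  by move=> t; rewrite /N /= !in_itv/= andbT => Lt /andP[_]; rewrite ltNge Lt.
have mP : measurable (`]0, +oo[%classic : set (measurableTypeR R)) by exact: measurable_itv.
have DE : `]0, +oo[%classic `\` N = `]0, L[%classic :> set (measurableTypeR R).
  apply/seteqP; split => t; rewrite /N /= !in_itv/= !andbT.
    by move=> [-> /negP]; rewrite -ltNge.
  by move=> /andP[-> tL]; split => //; apply/negP; rewrite -ltNge.
have mln : measurable_fun (`]0, +oo[%classic : set (measurableTypeR R))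
    (fun t : measurableTypeR R => (ln (t : R))%:E).
  by apply/measurable_EFinP/measurable_funTS; exact: measurable_ln.
have lnP : nu.-integrable `]0, +oo[ (fun t : measurableTypeR R => (ln (t : R))%:E).
  by apply/(negligible_integrable mN mP mln N0); rewrite DE.
rewrite /ln_det; case: asboolP => [_|/(_ (stieltjes_integrable fE lnP))//].
by rewrite (stieltjes_integral fE) (negligible_integral mN mP lnP N0) DE.
Qed.
End ln_det.

(** * Passage to the limit *)

Section moments.
Context {R : realType} {G : groupType} {d : nat}.
Variable A : 'M[zgroup_ring G]_d.
Local Notation K := (coef_norm A).
Local Notation L := (K.+1%:R : R).
Local Notation D := (`[0, L[%classic : set (measurableTypeR R)).

(** A single polynomial involves finitely many moments, so one model with moment error [e / C]
    suffices, where [C] exceeds the sum of the absolute values of the coefficients. *)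
Lemma moment_poly_le0 (Q : {poly R}) : sofic R G ->
  (forall i j h, A i j h = A j i h^-1%g) ->
  (forall N (l : 'I_N -> R), (forall i, `|l i| <= K%:R) ->
     1 <= \prod_(i | l i != 0) `|l i| -> \sum_i Q.[l i] <= 0) ->
  \sum_(k < size Q) Q`_k * (moment A k)%:~R <= 0.
Proof.
move=> Gs As HQ; pose C := 1 + \sum_(k < size Q) `|Q`_k|.
have C0 : 0 < C by rewrite (lt_le_trans ltr01)// lerDl sumr_ge0.
apply/ler_addgt0Pr => e e0; rewrite add0r.
have [n [N [M [n0 _ Msym MK Mtr]]]] :=
  sofic_approximation (size Q) Gs As (divr_gt0 e0 C0).
have [l [ltr lK l1]] := symmetric_int_spectrum R Msym MK.
have nR : 0 < n%:R :> R by rewrite ltr0n.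
have trQ : \sum_(k < size Q) Q`_k * ((\tr (M ^+ k))%:~R / n%:R) <= 0.
  have -> : \sum_(k < size Q) Q`_k * ((\tr (M ^+ k))%:~R / n%:R) = (\sum_i Q.[l i]) / n%:R.
    under [X in _ = X / _]eq_bigr do rewrite horner_coef.
    rewrite exchange_big/= mulr_suml; apply: eq_bigr => k _.
    by rewrite ltr mulrA mulr_sumr.
  by rewrite pmulr_lle0 ?invr_gt0// HQ.
have : \sum_(k < size Q) Q`_k * (moment A k)%:~R <=
   \sum_(k < size Q) (Q`_k * ((\tr (M ^+ k))%:~R / n%:R) + `|Q`_k| * (e / C)).
  apply: ler_sum => k _; rewrite -lerBlDl -mulrBr.
  rewrite (le_trans (ler_norm _))// normrM ler_wpM2l// distrC Mtr//.
  by rewrite ltnW.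
move=> /le_trans; apply; rewrite big_split/= -mulr_suml.
rewrite -[leRHS]add0r lerD// mulrCA ler_piMr ?(ltW e0)// ler_pdivrMr// mul1r.
by rewrite /C lerDr.
Qed.

Lemma integral_moment_poly
    (nu : {finite_measure set (measurableTypeR R) -> \bar R}) (Q : {poly R}) :
  (forall k, \int[nu]_(t in D) (t : R) ^+ k = (moment A k)%:~R) ->
  \int[nu]_(t in D) Q.[t : R] = \sum_(k < size Q) Q`_k * (moment A k)%:~R.
Proof.
move=> nuE; have mD : measurable D by exact: measurable_itv.
have powi k : nu.-integrable D (EFin \o (fun t : measurableTypeR R => (t : R) ^+ k)).
  apply: (@integrable_bounded _ _ _ _ (L ^+ k)) => //.
  move=> t; rewrite /= in_itv/= => /andP[t0 tL].
  by rewrite ger0_norm ?exprn_ge0// lerXn2r ?nnegrE// ltW.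
have termi (c : nat -> R) k :
    nu.-integrable D (EFin \o (fun t : measurableTypeR R => c k * (t : R) ^+ k)).
  have := integrableZl mD (c k) (powi k); apply: eq_integrable => // t _.
have sumi (c : nat -> R) n :
    nu.-integrable D
      (EFin \o (fun t : measurableTypeR R => \sum_(k < n) c k * (t : R) ^+ k)) /\
    \int[nu]_(t in D) (\sum_(k < n) c k * (t : R) ^+ k) =
      \sum_(k < n) c k * (moment A k)%:~R.
  elim: n => [|n [IHi IHe]].
    rewrite big_ord0; split.
      have := finite_measure_integrable_cst nu 0 mD.
      by apply: eq_integrable => // t _ /=; rewrite big_ord0.
    by under eq_Rintegral do rewrite big_ord0; rewrite Rintegral_cst// mul0r.
  split.
    have := integrableD mD IHi (termi c n); apply: eq_integrable => // t _ /=.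
    by rewrite big_ord_recr.
  under eq_Rintegral do rewrite big_ord_recr/=.
  by rewrite RintegralD// IHe RintegralZl// nuE big_ord_recr.
under eq_Rintegral do rewrite horner_coef.
by have [_ ->] := sumi (fun k => Q`_k) (size Q).
Qed.

Lemma log_poly_integral_le_of_moment
    (nu : {finite_measure set (measurableTypeR R) -> \bar R}) :
  sofic R G -> (forall i j h, A i j h = A j i h^-1%g) ->
  (forall k, \int[nu]_(t in D) (t : R) ^+ k = (moment A k)%:~R) ->
  forall M m, ln (L ^+ 2) <= log_poly M 0 ->
    \int[nu]_(t in D) log_poly M (((t : R) / L) ^+ 2) <=
    ln (L ^+ 2) * fine (nu D) +
    (log_poly M 0 - ln (L ^+ 2)) * \int[nu]_(t in D) (1 - ((t : R) / L) ^+ 2) ^+ m.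
Proof.
move=> Gs As nuE M m; set c := ln _ => cM.
have mD : measurable D by exact: measurable_itv.
have L0 : 0 < L by rewrite ltr0n.
have [B BE] : exists B : {poly R}, forall t, B.[t] = 1 - (t / L) ^+ 2.
  by exists (1 - (L^-1 *: 'X) ^+ 2) => t; rewrite !hornerE mulrC.
(* The difference of the two sides as one polynomial in [t]; [sum_log_poly_le] says that its sum
   over a finite spectrum is at most [0]. *)
pose Q : {poly R} := \sum_(j < M) (j.+1%:R^-1 *: B ^+ j.+1) - c%:P
  - (log_poly M 0 - c) *: B ^+ m.
have QE t : Q.[t] = log_poly M ((t / L) ^+ 2) - c
    - (log_poly M 0 - c) * (1 - (t / L) ^+ 2) ^+ m.
  rewrite /Q !hornerE horner_sum BE; congr (_ - _ - _).
  by apply: eq_bigr => j _; rewrite !hornerE BE mulrC.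
have Qle : \int[nu]_(t in D) Q.[t : R] <= 0.
  rewrite integral_moment_poly//; apply: moment_poly_le0 => // N l lK l1.
  have lL i : `|l i| <= L by rewrite (le_trans (lK i))// ler_nat.
  have := sum_log_poly_le m L0 lL l1 cM; rewrite -/c -subr_le0 -sumrB.
  by congr (_ <= 0); apply: eq_bigr => i _; rewrite QE opprD addrA.
have mon t : D t -> 0 <= (t / L) ^+ 2 <= 1.
  rewrite /= in_itv/= => /andP[t0 /ltW tL]; rewrite sqr_ge0/=.
  by rewrite -[leRHS](expr1n _ 2) lerXn2r ?nnegrE ?divr_ge0// ler_pdivrMr ?mul1r.
have ma : measurable_fun D (fun t : measurableTypeR R => ((t : R) / L) ^+ 2).
  by apply: measurable_funTS; apply: measurable_funX; apply: measurable_funM.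
have i1 : nu.-integrable D
    (EFin \o (fun t : measurableTypeR R => log_poly M (((t : R) / L) ^+ 2))).
  apply: (@integrable_bounded _ _ _ _ (log_poly M 0)) => //.
    exact: (measurableT_comp (measurable_log_poly M)).
  by move=> t /mon /andP[t0 t1]; rewrite ger0_norm ?log_poly_ge0 ?log_poly_le0.
have i2 : nu.-integrable D
    (EFin \o (fun t : measurableTypeR R => (1 - ((t : R) / L) ^+ 2) ^+ m)).
  apply: (@integrable_bounded _ _ _ _ 1) => //.
    by apply: measurable_funX; apply: measurable_funB.
  move=> t /mon /andP[t0 t1]; rewrite ger0_norm ?exprn_ge0 ?subr_ge0//.
  by rewrite exprn_ile1 ?subr_ge0// gerBl.
have ci (r : R) : nu.-integrable D (EFin \o cst r) by exact: finite_measure_integrable_cst.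
have i3 : nu.-integrable D
    (EFin \o (fun t : measurableTypeR R => log_poly M (((t : R) / L) ^+ 2) - c)).
  by have := integrableB mD i1 (ci c).
have i4 : nu.-integrable D (EFin \o (fun t : measurableTypeR R =>
    (log_poly M 0 - c) * (1 - ((t : R) / L) ^+ 2) ^+ m)).
  by have := integrableZl mD (log_poly M 0 - c) i2.
move: Qle; under eq_Rintegral do rewrite QE.
rewrite (RintegralB mD i3 i4) (RintegralB mD i1 (ci c)) (RintegralZl _ mD i2).
by rewrite Rintegral_cst//; lra.
Qed.
End moments.

Theorem theorem5 (R : realType) (G : groupType)
    (countable_G : countable [set: G]) (sofic_G : sofic R G)
    (d : nat) (d_ge1 : (1 <= d)%N) (Delta : 'M[zgroup_ring G]_d)
    (Delta_selfadjoint : selfadjoint (mx_act (R := R) Delta))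
    (Delta_positive : positive (mx_act (R := R) Delta)) :
  (0 <= ln_det (mx_act (R := R) Delta))%E.
Proof.
have Dc := selfadjoint_coef Delta_selfadjoint.
set T := mx_act Delta in Delta_selfadjoint Delta_positive *.
pose L : R := (coef_norm Delta).+1%:R.
have L1 : 1 <= L by rewrite ler1n.
(* In the default branch of [spectral_projection] the density vanishes, and the zero measure
   satisfies all the requirements of [ln_det_ge0]. *)
have [[E TE TE']|T0] := spectral_densityP T; last first.
  apply: (@ln_det_ge0 _ _ _ T mzero L) => //.
  - by move=> x; rewrite /spectral_density T0 /vN_trace big1// => i _; rewrite dot0l.
  - move=> M m _; rewrite /Rintegral !integral_measure_zero.
    by rewrite /mzero/= !mulr0 addr0.
have TZ (a : R) : {morph T : u / a%:C%C *: u} by move=> u; rewrite /T linearZ.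
have TD : {morph T : u v / u + v} by move=> u v; rewrite /T linearD.
have /choice[mu muE] : forall i : 'I_d,
    exists mu : {finite_measure set (measurableTypeR R) -> \bar R},
    forall A, measurable A ->
      rdot (E A (basis_vector (i, 1%g))) (basis_vector (i, 1%g)) = fine (mu A).
  move=> i; have [mu [muE _ _]] := spectral_integral TE (basis_vector (i, 1%g)).
  by exists mu => A mA; rewrite /rdot muE.
have mD : measurable (`[0, L[%classic : set (measurableTypeR R)) by exact: measurable_itv.
have sumE (A : set (measurableTypeR R)) : measurable A ->
    fine (sum_measure mu A) = \sum_i fine (mu i A).
  by move=> mA; rewrite sum_measureE -sum_fine// => i _; exact: fin_num_measure.
apply: (@ln_det_ge0 _ _ _ T (sum_measure mu) L) => //.
- move=> x; rewrite sumE; last exact: measurable_itv.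
  rewrite /spectral_density TE' /vN_trace.
  rewrite (raddf_sum (@complex.Re R : Rcomplex R -> R)).
  by apply: eq_bigr => i _; rewrite -muE.
- rewrite -[LHS]/(sum_measure mu (~` `[0, L[%classic)) sum_measureE big1// => i _.
  exact: (spectral_support TE Delta_positive (@norm_rdot_mx_act _ _ _ Delta) (muE i)).
apply: log_poly_integral_le_of_moment => // k.
rewrite /Rintegral ge0_integral_sum_measure//; last 2 first.
- by move=> t; rewrite /= in_itv/= lee_fin => /andP[t0 _]; rewrite exprn_ge0.
- by apply/measurable_EFinP.
rewrite -sum_fine => [|i _].
  rewrite /moment rmorph_sum; apply: eq_bigr => i _.
  rewrite -/(Rintegral _ _ (fun t : measurableTypeR R => (t : R) ^+ k)).
  rewrite (spectral_moment TE TD TZ Delta_selfadjoint Delta_positive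
    (@norm_rdot_mx_act _ _ _ Delta) k (muE i)).
  by rewrite rdot_basis iter_mx_act_basis -(rmorph_int (real_complex R)).
apply: integrable_fin_num => //.
apply: (@integrable_bounded _ _ _ _ (L ^+ k)) => // t.
rewrite /= in_itv/= => /andP[t0 tL].
by rewrite ger0_norm ?exprn_ge0// lerXn2r ?nnegrE// ltW.
Qed.
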